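(* For every integer $n>0$, let $X_n$ be the set of noncrossing $(1,2)$-configurations on $[n-1]=\{1,\dots,n-1\}$, and let $C_{X_n}$ be the cyclic group of order $n-1$ acting on $X_n$ via the cyclic permutation $g$ of $[n-1]$ given by $g(i)=i+1$ for $i\neq n-1$ and $g(n-1)=1$ (applied elementwise to each ball and arc). Then the triple $(X_n, C_{X_n}, C_n(q))$ exhibits the cyclic sieving phenomenon, where $C_n(q)=\frac{1}{[n+1]_q}{2n \brack n}_q$. Concretely, for every integer $k$, \[\left|\{F\in X_n : g^k(F)=F\}\right| = C_n(q)\big|_{q=e^{2\pi i k/(n-1)}}.\]
   Context: A subset of $[m]=\{1,\dots,m\}$ is a ball if it has cardinality $1$ and an arc if it has cardinality $2$. A $(1,2)$-configuration on $[m]$ is a set of pairwise disjoint balls and arcs in $[m]$ (the empty configuration is allowed, and not every element must be covered). A $(1,2)$-configuration has a crossing if it contains arcs $\{i_1,i_2\}$ and $\{j_1,j_2\}$ with $i_1<j_1<i_2<j_2$; otherwise it is noncrossing. $q$-notation: $[n]_q=1+q+\dots+q^{n-1}$, $[n]_q!=[1]_q[2]_q\cdots[n]_q$, ${n\brack k}_q=\frac{[n]_q!}{[n-k]_q![k]_q!}$; the $q$-Catalan number $C_n(q)$ is a polynomial in $q$ with nonnegative integer coefficients. Cyclic sieving phenomenon: for a finite set $X$ with an action of a cyclic group $C$, a polynomial $X(q)$ with nonnegative integer coefficients, and an embedding $\omega: C\hookrightarrow\mathbb{C}^*$ onto the $|C|$-th roots of unity, the triple $(X,C,X(q))$ exhibits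 the CSP if $|\{x\in X: c(x)=x\}|=X(\omega(c))$ for all $c\in C$. Here $\omega(g^k)=e^{2\pi i k/(n-1)}$. *)

(* Defs.v *)
From HB Require Import structures.
From mathcomp Require Import all_boot all_order all_algebra all_fingroup all_solvable.
From mathcomp Require Import complex.
From mathcomp Require Import reals trigo.
From mathcomp Require Import zify ring.
Set Implicit Arguments.
Unset Strict Implicit.
Unset Printing Implicit Defensive.

Import Order.TTheory GRing.Theory Num.Theory.
Local Open Scope ring_scope.

Definition qnum (n : nat) : {poly int} := \sum_(i < n) 'X^i.

Definition qfact (n : nat) : {poly int} := \prod_(1 <= i < n.+1) qnum i.

(* Both divisors below are monic, so %/ is Euclidean division in {poly int};
   both divisions are exact (lemmas qbinomE and qCatalanE). *)
Definition qbinom (n k : nat) : {poly int} :=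
  qfact n %/ (qfact (n - k) * qfact k).

Definition qCatalan (n : nat) : {poly int} := qbinom (2 * n) n %/ qnum n.+1.

Lemma qnumS n : qnum n.+1 = qnum n + 'X^n.
Proof. by rewrite /qnum big_ord_recr. Qed.

Lemma qnumD m n : qnum (m + n) = qnum m + 'X^m * qnum n.
Proof.
rewrite /qnum big_split_ord /= mulr_sumr; congr (_ + _).
by apply: eq_bigr => i _; rewrite exprD.
Qed.

Lemma qfactS n : qfact n.+1 = qfact n * qnum n.+1.
Proof. by rewrite /qfact big_nat_recr. Qed.

Lemma size_qnum n : size (qnum n) = n.
Proof.
elim: n => [|n IHn]; first by rewrite /qnum big_ord0 size_poly0.
by rewrite qnumS addrC size_polyDl size_polyXn ?IHn.
Qed.

Lemma qnum_monic n : qnum n.+1 \is monic.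
Proof.
by rewrite monicE qnumS addrC lead_coefDl ?lead_coefXn // size_polyXn size_qnum.
Qed.

Lemma qfact_monic n : qfact n \is monic.
Proof.
elim: n => [|n IHn]; first by rewrite /qfact big_geq ?monic1.
by rewrite qfactS monicMl ?qnum_monic.
Qed.

Lemma mulpK_monic (p d : {poly int}) : d \is monic -> (p * d) %/ d = p.
Proof. by move=> dm; apply: Pdiv.IdomainMonic.mulpK. Qed.

Lemma qfact_dvd a b :
  exists G : {poly int}, qfact (a + b) = G * (qfact a * qfact b).
Proof.
have [s] := ubnP (a + b); elim: s a b => // s IHs [|a] [|b] lt_s.
- by exists 1; rewrite /qfact big_geq ?mulr1.
- by exists 1; rewrite add0n {2}/qfact big_geq // !mul1r.
- by exists 1; rewrite addn0 {3}/qfact big_geq // mulr1 mul1r.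
have [|G1 e1] := IHs a b.+1; first by rewrite addSn in lt_s.
have [|G2 e2] := IHs a.+1 b; first by rewrite addnS in lt_s.
exists (G1 + 'X^(a.+1) * G2).
rewrite addSn qfactS -addSn qnumD.
rewrite mulrDr {1}e1 -addSnnS e2 !qfactS; ring.
Qed.

Lemma qbinomE n k : (k <= n)%N ->
  qbinom n k * (qfact (n - k) * qfact k) = qfact n.
Proof.
move=> le_kn; have [G] := qfact_dvd (n - k) k; rewrite subnK // => e.
by rewrite /qbinom e mulpK_monic // monicMl ?qfact_monic.
Qed.

Lemma qCatalanE n : qCatalan n * qnum n.+1 = qbinom (2 * n) n.
Proof.
suff [P eP] : exists P, qbinom (2 * n) n = P * qnum n.+1.
  by rewrite /qCatalan eP mulpK_monic ?qnum_monic.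
case: n => [|n].
  by exists (qbinom 0 0); rewrite muln0 /qnum big_ord1 expr0 mulr1.
pose G := qbinom (2 * n.+1) n.+1; pose H := qbinom (2 * n.+1) n.
have eG := qbinomE (leq_pmull n.+1 (isT : 0 < 2)%N).
have eH : H * (qfact n.+2 * qfact n) = qfact (2 * n.+1).
  have le_n : (n <= 2 * n.+1)%N by rewrite mul2n -addnn leqW ?leq_addr.
  by rewrite -(qbinomE le_n); congr (_ * (qfact _ * _)); lia.
have eGH : G * qnum n.+1 = H * qnum n.+2.
  have nz : qfact n.+1 * qfact n != 0.
    by rewrite mulf_neq0 // monic_neq0 ?qfact_monic.
  apply: (mulIf nz); move: eG; rewrite -eH -/G.
  have -> : (2 * n.+1 - n.+1 = n.+1)%N by lia.
  rewrite {2}qfactS (qfactS n.+1) => e.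
  by transitivity (G * (qfact n.+1 * (qfact n * qnum n.+1)));
    [ring | rewrite e; ring].
exists (G - 'X * H); rewrite -/G.
have e1 : qnum n.+2 = 1 + 'X * qnum n.+1.
  by rewrite -add1n qnumD expr1 /qnum big_ord1 expr0.
rewrite mulrBl -mulrA -eGH {1}e1; ring.
Qed.

(* The set {1, ..., m} is represented by 'I_m = {0, ..., m - 1}, with i
   standing for i + 1. *)
Definition is_ball (m : nat) (A : {set 'I_m}) := #|A| == 1%N.

Definition is_arc (m : nat) (A : {set 'I_m}) := #|A| == 2%N.

Definition is_configuration (m : nat) (F : {set {set 'I_m}}) :=
  [forall A in F, is_ball A || is_arc A] && trivIset F.

Definition has_crossing (m : nat) (F : {set {set 'I_m}}) :=
  [exists i1 : 'I_m, exists i2 : 'I_m, exists j1 : 'I_m, exists j2 : 'I_m,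
    [&& [set i1; i2] \in F, [set j1; j2] \in F,
        (i1 < j1)%N, (j1 < i2)%N & (i2 < j2)%N]].

Definition nc_configurations (m : nat) : {set {set {set 'I_m}}} :=
  [set F | is_configuration F && ~~ has_crossing F].

(* i |-> i + 1, with m - 1 |-> 0; for m = 0 it generates the trivial group, of
   order 1 rather than 0. *)
Definition cshift (m : nat) : 'S_m := perm (@ordS_inj m).

Lemma cshiftX m k (i : 'I_m) : (cshift m ^+ k)%g i = ((i + k) %% m)%N :> nat.
Proof.
elim: k => [|k IHk]; first by rewrite expg0 perm1 addn0 modn_small.
by rewrite expgSr permM permE /= IHk -addn1 modnDml addn1 addnS.
Qed.

Lemma order_cshift m : (0 < m)%N -> #[cshift m]%g = m.
Proof.
case: m => // m _; apply/eqP; rewrite eqn_dvd; apply/andP; split.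
  rewrite order_dvdn; apply/eqP/permP => i; apply: val_inj.
  by rewrite /= perm1 cshiftX modnDr modn_small.
have := cshiftX #[cshift m.+1]%g (ord0 : 'I_m.+1).
by rewrite expg_order perm1 add0n /dvdn => <-.
Qed.

Definition expgz (gT : finGroupType) (x : gT) (k : int) : gT :=
  match k with Posz n => (x ^+ n)%g | Negz n => (x ^- n.+1)%g end.

Definition expi (R : realType) (t : R) : R[i] := Complex (cos t) (sin t).

Definition evalC (R : realType) (P : {poly int}) (z : R[i]) : R[i] :=
  (map_poly intr P).[z].

(* omega embeds the group C onto the #|C|-th roots of unity in R[i]; its values
   outside C are irrelevant. *)
Definition root_embedding (R : realType) (gT : finGroupType) (C : {group gT})
    (omega : gT -> R[i]) : Prop :=
  [/\ {in C &, forall x y, omega (x * y)%g = omega x * omega y},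
      {in C &, injective omega}
    & forall z : R[i], z ^+ #|C| = 1 <-> exists2 c, c \in C & omega c = z].

Definition exhibits_CSP (R : realType) (gT : finGroupType) (T : finType)
    (to : {action gT &-> T}) (X : {set T}) (C : {group gT})
    (P : {poly int}) (omega : gT -> R[i]) : Prop :=
  [/\ cyclic C, [acts C, on X | to], forall i, 0 <= P`_i,
      root_embedding C omega
    & {in C, forall c, #|[set x in X | to x c == x]|%:R = evalC P (omega c)}].

(* Main.v *)
(** Let the rotation by [k] have order [d] on [m = n - 1 = d r] points.  A
configuration fixed by it is encoded by a word of length [r] over four letters,
stored as pairs of booleans: opening end of an arc [(true, false)], closing end
[(false, true)], ball [(true, true)], uncovered point [(false, false)].  For
[d >= 2] an invariant arc spans fewer than [r] steps on one side, which orients it,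
except that for [d = 2] there may be one orbit of diameters, consisting of two
opening letters.  For [d = 1] arcs are oriented from left to right.

A word determines its configuration, by induction on the length of the arcs.  A
word comes from a configuration as soon as it is balanced (up to one extra opening
letter if [d = 2], and with the ballot condition if [d = 1]), by induction on the
number of closing letters: match an opening letter with an adjacent closing letter
and delete both.  Counting words gives [C(2r, r)] for [d >= 3], [C(2r+1, r+1)] for
[d = 2] and the Catalan number for [d = 1]; the q-Lucas theorem applied to
[C_n(q) = [2n, n]_q - q [2n, n-1]_q] gives the same values at a primitive [d]-th
root of unity.  Nonnegativity of the coefficients follows from MacMahon's
description of [C_n(q)] as the generating function of ballot words by major index. *)

Require Import Defs.
From HB Require Import structures.
From mathcomp Require Import all_boot all_order all_algebra all_fingroup all_solvable.
From mathcomp Require Import complex.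
From mathcomp Require Import reals trigo.
From mathcomp Require Import zify ring lra.
Set Implicit Arguments.
Unset Strict Implicit.
Unset Printing Implicit Defensive.

(** * Rotation-invariant noncrossing relations *)

Lemma eqmod_close m x y : x = y %[mod m] -> x < y + m -> y < x + m -> x = y.
Proof.
wlog le_xy : x y / x <= y.
  move=> H e1 h1 h2; case: (leqP x y) => [/H -> //|/ltnW /H <- //].
move=> e _ h; apply/eqP; rewrite eqn_leq le_xy /= -subn_eq0.
have : m %| y - x by rewrite -eqn_mod_dvd // e.
case: (posnP (y - x)) => [-> //|p /(dvdn_leq p)]; lia.
Qed.

Lemma divn_eq_close r x y : 0 < r -> x %/ r = y %/ r -> y < x + r.
Proof.
move=> r0 e; rewrite (divn_eq x r) (divn_eq y r) e.
by have := ltn_pmod y r0; lia.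
Qed.

Lemma modnD_period T (f : nat -> T) r : (forall x, f (x + r) = f x) ->
  forall x, f (x %% r) = f x.
Proof.
move=> fr x; rewrite {2}(divn_eq x r); elim: (x %/ r) => [|k IH] //.
by rewrite mulSn addnC addnA (addnC _ r) -addnA addnC fr addnC.
Qed.

(** An injection given as a relation, so that no image has to be chosen by a function: remove a
    point of [A] together with one related point of [B] and induct. *)
Lemma leq_card_rel (T T' : finType) (A : {set T}) (B : {set T'})
    (R : T -> T' -> Prop) :
  (forall i, i \in A -> exists2 j, j \in B & R i j) ->
  (forall i i' j, i \in A -> i' \in A -> R i j -> R i' j -> i = i') ->
  #|A| <= #|B|.
Proof.
have [n] := ubnP #|A|; elim: n A B => // n IHn A B lt_n AB Rinj.
have [->|[i iA]] := set_0Vmem A; first by rewrite cards0.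
have [j jB Rij] := AB _ iA.
rewrite (cardsD1 i A) (cardsD1 j B) iA jB leq_add2l; apply: IHn.
- by move: lt_n; rewrite (cardsD1 i A) iA.
- move=> k; rewrite !inE => /andP[ki kA]; have [l lB Rkl] := AB _ kA.
  exists l => //; rewrite !inE lB andbT; apply: contra ki => /eqP elj.
  by rewrite elj in Rkl; apply/eqP; apply: Rinj Rkl Rij.
- by move=> k k' l; rewrite !inE => /andP[_ kA] /andP[_ kA']; apply: Rinj.
Qed.

Lemma leq_sum_rel (j j' : nat) (P Q : pred nat) (R : nat -> nat -> Prop) :
  (forall i, i < j -> P i -> exists k, [/\ k < j', Q k & R i k]) ->
  (forall i i' k, i < j -> i' < j -> P i -> P i' -> R i k -> R i' k -> i = i') ->
  \sum_(i < j) P i <= \sum_(i < j') Q i.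
Proof.
move=> PQ Rinj.
have E n (p : pred nat) : \sum_(i < n) p i = #|[set i : 'I_n | p i]|.
  rewrite -sum1_card [RHS]big_mkcond /=; apply: eq_bigr => i _.
  by rewrite inE; case: (p i).
rewrite !E; apply: (@leq_card_rel _ _ _ _ (fun (i : 'I_j) (k : 'I_j') => R i k)) => [i|i i' k].
  rewrite inE => Pi; have [k [lt Qk Rik]] := PQ i (ltn_ord i) Pi.
  by exists (Ordinal lt) => //; rewrite inE.
rewrite !inE => Pi Pi' R1 R2; apply: val_inj.
exact: Rinj (ltn_ord i) (ltn_ord i') Pi Pi' R1 R2.
Qed.

Lemma eqmod_lt2 r x x' : x = x' %[mod r] -> x < r + r -> x' < r + r ->
  [\/ x = x', x' = x + r | x = x' + r].
Proof.
move=> e lt lt'; have [h|h] := ltnP x' (x + r); last first.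
  apply: Or32; apply: (@eqmod_close r); rewrite ?modnDr -?e //; lia.
have [h'|h'] := ltnP x (x' + r); first by apply: Or31; apply: (@eqmod_close r).
by apply: Or33; apply: (@eqmod_close r); rewrite ?modnDr ?e //; lia.
Qed.

Notation letters := (nat -> bool * bool).

Definition count_letter (w : letters) (c : bool * bool) (j : nat) : nat :=
  \sum_(i < j) (w i == c).

Definition n_open (w : letters) := count_letter w (true, false).
Definition n_close (w : letters) := count_letter w (false, true).

(* The admissible words of length [r] when the rotation has order [d]: an
   unmatched opening letter is possible only for [d = 2], where it is a diameter. *)
Definition admissible (d r : nat) (w : letters) : bool :=
  if d == 1 then
    [forall j : 'I_r, n_close w j <= n_open w j] && (n_open w r == n_close w r)
  else (n_open w r == n_close w r) || (d == 2) && (n_open w r == (n_close w r).+1).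

(* [K x y] encodes that the pair [{x, y}], read modulo [m], is a block; a ball
   is the case [x = y]. *)
Definition nc_rel (m r : nat) (K : rel nat) : Prop :=
  [/\ forall x y, K (x + m) y = K x y,
      forall x y, K x y = K y x,
      forall x y z, K x y -> K x z -> y = z %[mod m],
      forall x t s u, x < t < s -> s < u < x + m -> K x s -> K t u -> False
    & forall x y, K (x + r) (y + r) = K x y].

(** The orientation of a pair, on the universal cover of the circle. For [d = 1] both ends lie in
    the same period and the arc runs from left to right; otherwise it runs along the side of length
    at most [r], where length [r] is a diameter and occurs only for [d = 2]. *)
Definition arc (d r : nat) (K : rel nat) : rel nat := fun x y =>
  [&& x < y, (if d == 1 then x %/ r == y %/ r else y <= x + r) & K x y].

Definition opener (d r : nat) (K : rel nat) (x : nat) :=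
  has (arc d r K x) (iota x (r + r)).

(* The position is shifted by [r] so that the partner of [y] is a natural number. *)
Definition closer (d r : nat) (K : rel nat) (y : nat) :=
  has (fun x => arc d r K x (y + r)) (iota y.+1 r.-1).

Section NoncrossingRel.

Variables (m d r : nat).
Hypotheses (d_gt0 : 0 < d) (r_gt0 : 0 < r) (def_m : m = d * r).

Lemma d_cases : d = 1 /\ m = r \/ 1 < d /\ r + r <= m.
Proof. by rewrite def_m; case: d d_gt0 => [|[|d']] // _; [left|right]; nia. Qed.

Section OneRel.

Variable K : rel nat.
Hypothesis ncK : nc_rel m r K.

Let a := arc d r K.

Lemma arc_lt x y : a x y -> x < y.
Proof. by case/and3P. Qed.

Lemma arc_rel x y : a x y -> K x y.
Proof. by case/and3P. Qed.

Lemma arc_le x y : a x y -> y <= x + r.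
Proof.
case/and3P=> _; case: eqP => _ // /eqP e _.
by rewrite ltnW // divn_eq_close.
Qed.

Lemma arc1_lt x y : d = 1 -> a x y -> y < x + r.
Proof. by rewrite /a /arc => -> /and3P [_ /= /eqP e _]; apply: divn_eq_close. Qed.

Lemma arc_shift x y : a (x + r) (y + r) = a x y.
Proof.
case: ncK => _ _ _ _ Kr; rewrite /a /arc Kr ltn_add2r !divnDr ?dvdnn //.
by rewrite eqn_add2r leq_add2r.
Qed.

(** Two overlapping arcs fit into one turn, where congruence modulo [m] becomes equality and the
    noncrossing condition applies. For [d = 1] all ends lie in one period; otherwise the two lengths
    add up to less than [r + r <= m], counted from [x]. *)
Lemma arc_window x y x' y' : a x y -> a x' y' -> x <= x' <= y ->
  (x' < y) || (y < x + r) -> y' < x + m.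
Proof.
move=> axy ax'y' /andP[h1 h2] h3; case: d_cases => [[d1 ->]|[d1 le_m]].
  move: axy ax'y'; rewrite /a /arc d1 /= => /and3P[_ /eqP e1 _].
  move=> /and3P[_ /eqP e2 _]; apply: divn_eq_close => //.
  apply/eqP; rewrite -e2 eqn_leq leq_div2r //= e1 leq_div2r //.
have := arc_le axy; have := arc_le ax'y'; lia.
Qed.

Lemma relP x y z : K x y -> K x z -> y < z + m -> z < y + m -> y = z.
Proof.
by case: ncK => _ _ Ku _ _ k1 k2 h1 h2; apply: (@eqmod_close m) => //; apply: Ku k1 k2.
Qed.

Lemma relC x y : K x y = K y x. Proof. by case: ncK. Qed.

Lemma le_rm : r <= m. Proof. by rewrite def_m leq_pmull. Qed.

Lemma arc_funl x y y' : a x y -> a x y' -> y = y'.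
Proof.
move=> h h'; have := le_rm.
have := arc_lt h; have := arc_lt h'; have := arc_le h; have := arc_le h'.
by move=> *; apply: relP (arc_rel h) (arc_rel h') _ _; lia.
Qed.

Lemma arc_funr x x' y : a x y -> y < x + r -> a x' y -> x = x'.
Proof.
move=> h hs h'; have := le_rm; have := arc_lt h; have := arc_lt h'.
have := arc_le h'; move: (arc_rel h) (arc_rel h'); rewrite ![K _ y]relC.
by move=> k k' *; apply: relP k k' _ _; lia.
Qed.

(** Otherwise [y] would have two distinct partners. The bound [y < x + r] excludes a diameter, whose
    far end [x + r] is again an opening end. *)
Lemma arc_chain x y z : a x y -> y < x + r -> a y z -> False.
Proof.
move=> h hs h'; have lxy := arc_lt h; have lyz := arc_lt h'.
have W : z < x + m by apply: (arc_window h h'); rewrite ?hs ?orbT // leqnn ltnW.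
move: (arc_rel h) (arc_rel h'); rewrite [K x y]relC => k k'.
have := relP k k'; lia.
Qed.

Lemma arc_ballF x y : a x y -> y < x + m.
Proof.
move=> h; case: d_cases => [[d1 e]|[_ H]]; first by rewrite e; apply: arc1_lt h.
have := arc_le h; have := arc_lt h; lia.
Qed.

Lemma ball_arcl x y : K x x -> a x y -> False.
Proof.
move=> k h; have := arc_ballF h; have := arc_lt h => *.
have := relP k (arc_rel h); lia.
Qed.

Lemma ball_arcr x y : K y y -> a x y -> False.
Proof.
move=> k h; have := arc_ballF h; have := arc_lt h => *.
by have := relP k (_ : K y x); rewrite relC => /(_ (arc_rel h)); lia.
Qed.

Lemma arc_cross x y x' y' : a x y -> a x' y' -> x < x' < y -> y <= y' -> y = y'.
Proof.
move=> h h' /andP[h1 h2]; rewrite leq_eqVlt => /orP[/eqP //|h3].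
have W : y' < x + m by apply: (arc_window h h'); rewrite ?h2 // ltnW //= ltnW.
case: ncK => _ _ _ Kc _; exfalso; apply: (Kc x x' y y').
- by rewrite h1.
- by rewrite h3.
- exact: arc_rel h.
- exact: arc_rel h'.
Qed.

Lemma openerP x : reflect (exists y, a x y) (opener d r K x).
Proof.
apply: (iffP hasP) => [[y _ h]|[y h]]; exists y => //.
rewrite mem_iota; have := arc_lt h; have := arc_le h; lia.
Qed.

Lemma closerP y :
  reflect (exists2 x, a x (y + r) & y < x) (closer d r K y).
Proof.
apply: (iffP hasP) => [[x]|[x h lt]].
  by rewrite mem_iota => /andP[h _] h'; exists x.
exists x => //; rewrite mem_iota lt /=; have := arc_lt h; lia.
Qed.

Lemma closerW x y : a x y -> y < x + r -> closer d r K y.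
Proof. by move=> h lt; apply/closerP; exists (x + r); rewrite ?arc_shift. Qed.

Lemma closerE y : r <= y -> closer d r K y -> exists2 x, a x y & y < x + r.
Proof.
move=> le_ry /closerP[x h lt]; exists (x - r); last lia.
by rewrite -arc_shift subnK //; lia.
Qed.

Lemma opener_shift x : opener d r K (x + r) = opener d r K x.
Proof.
apply/openerP/openerP => [[y h]|[y h]]; last by exists (y + r); rewrite arc_shift.
exists (y - r); rewrite -arc_shift subnK //; have := arc_lt h; lia.
Qed.

Lemma closer_shift x : closer d r K (x + r) = closer d r K x.
Proof.
apply/closerP/closerP => [[y h lt]|[y h lt]]; last first.
  by exists (y + r); rewrite ?arc_shift //; lia.
exists (y - r); last lia.
by rewrite -arc_shift subnK //; lia.
Qed.

Lemma ball_shift x : K (x + r) (x + r) = K x x.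
Proof. by case: ncK. Qed.

Lemma opener_ballF x : K x x -> opener d r K x -> False.
Proof. by move=> k /openerP[y]; apply: ball_arcl. Qed.

Lemma closer_ballF x : K x x -> closer d r K x -> False.
Proof.
by rewrite -ball_shift => k /closerP[y h _]; apply: ball_arcr k h.
Qed.

Lemma opener_closerF x : opener d r K x -> closer d r K x -> False.
Proof.
rewrite -opener_shift => /openerP[z h] /closerP[y h' lt].
by apply: (arc_chain h' _ h); rewrite ltn_add2r.
Qed.

(* An invariant chord longer than [r] on both sides would cross its own rotation
   by [r]. *)
Lemma rel_arc x y : K x y -> x < y < x + m -> a x y \/ a y (x + m).
Proof.
case: (ncK) => Km Kc _ Kx Kr k /andP[h1 h2].
rewrite /a /arc h1 h2 k Kc Km k !andbT /=; case: d_cases => [[d1 em]|[d1 lem]].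
  (* For [d = 1], the end [y] lies either in the period of [x] or in that of [x + m]. *)
  have hd : 0 < r by [].
  rewrite d1 /= em in h2 *; rewrite divnDr ?dvdnn // divnn hd addn1.
  have q1 : x %/ r <= y %/ r by rewrite leq_div2r // ltnW.
  have : y %/ r <= (x + r) %/ r by rewrite leq_div2r // ltnW.
  rewrite divnDr ?dvdnn // divnn hd addn1 leq_eqVlt => /orP[/eqP e|].
    by right; rewrite e eqxx.
  by rewrite ltnS => q2; left; rewrite eqn_leq q1 q2.
rewrite (gtn_eqF d1).
case: (leqP y (x + r)) => [_|l1]; first by left.
case: (leqP (x + m) (y + r)) => [_|l2]; first by right.
exfalso; apply: (Kx x (x + r) y (y + r)); rewrite ?Kr //; lia.
Qed.

Lemma rel_modl x x' y : x = x' %[mod m] -> K x y = K x' y.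
Proof.
case: ncK => Km _ _ _ _ e.
have P := @modnD_period _ (K^~ y) m (Km^~ y).
by rewrite -P e P.
Qed.

Lemma rel_mod x x' y y' : x = x' %[mod m] -> y = y' %[mod m] -> K x y = K x' y'.
Proof. by move=> e e'; rewrite (rel_modl _ e) relC (rel_modl _ e') relC. Qed.

Definition letter x := (opener d r K x || K x x, closer d r K x || K x x).

Lemma letter_shift x : letter (x + r) = letter x.
Proof. by rewrite /letter opener_shift closer_shift ball_shift. Qed.

Lemma letter_mod x : letter (x %% r) = letter x.
Proof. exact: modnD_period letter_shift _. Qed.

(** Being a ball, an opening end or a closing end exclude each other, so the letter recovers each of
    the three. *)
Lemma letterE x :
  [/\ K x x = (letter x == (true, true)), opener d r K x = (letter x == (true, false))
    & closer d r K x = (letter x == (false, true))].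
Proof.
have := @opener_ballF x; have := @closer_ballF x; have := @opener_closerF x.
rewrite /letter; case: (K x x); case: (opener d r K x); case: (closer d r K x) => //=.
all: try by [move=> /(_ isT isT) | move=> _ /(_ isT isT) | move=> _ _ /(_ isT isT)].
Qed.

End OneRel.

(** * A word determines its configuration *)

(** Induction on the length. If the arcs from [x] in [K] and [K'] end at different points, the
    nearer end closes an arc from some [z] in the other relation. A start [z < x] gives a crossing,
    [z = x] two partners, and [z > x] leads to a shorter arc or a crossing. *)
Lemma short_arc_transfer K K' : nc_rel m r K -> nc_rel m r K' ->
  opener d r K =1 opener d r K' -> closer d r K =1 closer d r K' ->
  forall x y, r <= x -> y < x + r -> arc d r K x y -> arc d r K' x y.
Proof.
move=> ncK ncK' eo ec x y; have [n] := ubnP (y - x).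
elim: n x y => // n IHn x y lt_n le_rx lt_y h; have lt_xy := arc_lt h.
have /openerP[y' h'] : opener d r K' x by rewrite -eo; apply/openerP; exists y.
have lt_xy' := arc_lt h'; case: (ltngtP y' y) => [lt|lt|<- //]; exfalso.
  (* Case [y' < y]: the arc of [K] ending at [y'] is the shorter one to which induction applies. *)
  have : closer d r K y' by rewrite ec; apply: (closerW ncK' h'); lia.
  case/(closerE ncK) => [|z hz lt_z]; first lia.
  have lt_zy := arc_lt hz; case: (ltngtP z x) => [lt_zx|lt_xz|ezx].
  - by have := arc_cross ncK hz h _ (ltnW lt); rewrite lt_zx lt_xy' => /(_ isT); lia.
  - have hz' : arc d r K' z y' by apply: (IHn z y' _ _ lt_z hz); lia.
    have := arc_funr ncK' hz' lt_z h'; lia.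
  - by rewrite ezx in hz; have := arc_funl ncK h hz; lia.
(* Case [y < y']: the start [z] of the arc of [K'] ending at [y] also opens in [K]. That arc either
   crosses the arc from [x] to [y], or is shorter and transfers to [K'], giving [z] two partners. *)
have : closer d r K' y by rewrite -ec; apply: (closerW ncK h).
case/(closerE ncK') => [|z hz lt_z]; first lia.
have lt_zy := arc_lt hz; case: (ltngtP z x) => [lt_zx|lt_xz|ezx].
- by have := arc_cross ncK' hz h' _ (ltnW lt); rewrite lt_zx lt_xy => /(_ isT); lia.
- have /openerP[y'' hz'] : opener d r K z.
    by rewrite eo; apply/openerP; exists y.
  have lt_zy'' := arc_lt hz'; case: (leqP y y'') => [le|lt''].
    have := arc_cross ncK h hz' _ le; rewrite lt_xz lt_zy => /(_ isT) ey.
    by rewrite -ey in hz'; have := arc_funr ncK h lt_y hz'; lia.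
  have hz'' : arc d r K' z y'' by apply: (IHn z y'' _ _ _ hz'); lia.
  by have := arc_funl ncK' hz hz''; lia.
- by rewrite ezx in hz; have := arc_funl ncK' h' hz; lia.
Qed.

(** Only diameters remain: if the arc of [K'] from [x] were shorter than [r], it would transfer back
    to [K]; so both have length exactly [r]. *)
Lemma arc_transfer K K' : nc_rel m r K -> nc_rel m r K' ->
  opener d r K =1 opener d r K' -> closer d r K =1 closer d r K' ->
  forall x y, r <= x -> arc d r K x y -> arc d r K' x y.
Proof.
move=> ncK ncK' eo ec x y le_rx h; have T := short_arc_transfer ncK ncK' eo ec.
have T' := short_arc_transfer ncK' ncK (fsym eo) (fsym ec).
case: (ltnP y (x + r)) => [lt|le]; first exact: T.
have /openerP[y' h'] : opener d r K' x by rewrite -eo; apply/openerP; exists y.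
suff -> : y = y' by [].
case: (ltnP y' (x + r)) => [lt|le']; first by apply: (arc_funl ncK h); apply: T'.
have := arc_le h; have := arc_le h'; lia.
Qed.

(** Representatives within one turn, at least [r] so that a shift back by [r] stays in the natural
    numbers. *)
Lemma eqmod_window x y : exists x' y',
  [/\ x' = x %[mod m], y' = y %[mod m], r <= x' & x' <= y' < x' + m].
Proof.
have m_gt0 : 0 < m by rewrite def_m muln_gt0 d_gt0.
pose x' := x %% m + m; exists x', (x' + (y + (m - x %% m)) %% m).
have lx := ltn_pmod x m_gt0; split; first by rewrite /x' modnDr modn_mod.
- rewrite modnDmr /x' (_ : _ + _ = y + m + m) ?modnDr //; lia.
- by rewrite (leq_trans le_rm) // leq_addl.
- by rewrite leq_addr ltn_add2l ltn_pmod.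
Qed.

Lemma letter_sub K K' : nc_rel m r K -> nc_rel m r K' ->
  letter K =1 letter K' -> forall x y, K x y -> K' x y.
Proof.
move=> ncK ncK' e x y k.
have eo : opener d r K =1 opener d r K'.
  by move=> z; case: (letterE ncK z) => _ -> _; case: (letterE ncK' z) => _ -> _; rewrite e.
have ec : closer d r K =1 closer d r K'.
  by move=> z; case: (letterE ncK z) => _ _ ->; case: (letterE ncK' z) => _ _ ->; rewrite e.
have eb z : K z z = K' z z.
  by case: (letterE ncK z) => -> _ _; case: (letterE ncK' z) => -> _ _; rewrite e.
have [x' [y' [ex ey le_rx ly]]] := eqmod_window x y.
move: k; rewrite -(rel_mod ncK ex ey) -(rel_mod ncK' ex ey).
case: (ltngtP x' y') => [lt_xy|lt_xy|<-]; last by rewrite eb.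
  move=> k; case: (rel_arc ncK k) => [|h|h]; first by lia.
    by apply: arc_rel (arc_transfer ncK ncK' eo ec le_rx h).
  have := arc_rel (arc_transfer ncK ncK' eo ec (leq_trans le_rx (ltnW lt_xy)) h).
  by rewrite relC // (@rel_modl _ ncK' _ x') // modnDr.
lia.
Qed.

Lemma letter_inj K K' : nc_rel m r K -> nc_rel m r K' ->
  (forall i, i < r -> letter K i = letter K' i) -> K =2 K'.
Proof.
move=> ncK ncK' e; have E : letter K =1 letter K'.
  by move=> x; rewrite -(letter_mod ncK) -(letter_mod ncK') e // ltn_pmod.
by move=> x y; apply/idP/idP; [apply: (letter_sub ncK ncK') | apply: (letter_sub ncK' ncK)].
Qed.

(** * Words of invariant configurations are admissible *)

Section Admissible.

Variable K : rel nat.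
Hypothesis ncK : nc_rel m r K.
Let w := letter K.

Lemma n_openE j : n_open w j = \sum_(i < j) opener d r K i.
Proof.
apply: eq_bigr => i _.
by have [_ -> _] := letterE ncK i.
Qed.

Lemma n_closeE j : n_close w j = \sum_(i < j) closer d r K i.
Proof.
apply: eq_bigr => i _.
by have [_ _ ->] := letterE ncK i.
Qed.

(** Each closing letter is sent to the residue modulo [r] of the start of its arc; equal residues
    give the same arc up to a shift. For [d = 1] the start precedes the end in the word, so the map
    preserves every prefix. *)
Lemma leq_close_open j : d = 1 \/ j = r -> j <= r -> n_close w j <= n_open w j.
Proof.
move=> dj le_j; rewrite n_openE n_closeE.
apply: (@leq_sum_rel _ _ _ _
  (fun i k => exists x, [/\ arc d r K x (i + r), i < x & x %% r = k])).
  move=> i lt_i /(closerP)[x h lt]; exists (x %% r); split; last by exists x.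
  - case: dj => [d1|->]; last exact: ltn_pmod.
    move: h; rewrite /arc d1 => /and3P[l /= /eqP e _].
    have lx : x < i + r by [].
    have : x %/ r = 1 by rewrite e divnDr ?dvdnn // divnn r_gt0 divn_small //; lia.
    by have := divn_eq x r => + q; rewrite q; lia.
  - have P := @modnD_period _ (opener d r K) r.
    by rewrite P; [apply/openerP => //; exists (i + r) | apply: opener_shift ncK].
move=> i i' k lt_i lt_i' _ _ [x [h lt ex]] [x' [h' lt' ex']].
have lx := arc_lt h; have lx' := arc_lt h'.
have F := arc_funl ncK.
have [||e|e|e] := @eqmod_lt2 r x x' (etrans ex (esym ex')); try lia.
- by move: h'; rewrite -e => h'; have := F _ _ _ h h'; lia.
- by move: h; rewrite -(arc_shift ncK) -e => h; have := F _ _ _ h h'; lia.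
- by move: h'; rewrite -(arc_shift ncK) -e => h'; have := F _ _ _ h h'; lia.
Qed.

(** The reverse map: an opening letter that is not the end of a diameter is sent to the residue of
    the end of its arc. *)
Lemma leq_short_open :
  \sum_(i < r) (opener d r K i && ~~ K i (i + r)) <= n_close w r.
Proof.
rewrite n_closeE.
apply: (@leq_sum_rel _ _ (fun i => opener d r K i && ~~ K i (i + r)) _
  (fun i k => exists y, [/\ arc d r K i y, y < i + r & y %% r = k])).
  move=> i lt_i /andP[/(openerP)[y h] nd].
  have lt_y : y < i + r.
    rewrite ltn_neqAle (arc_le h) andbT; apply: contra nd => /eqP <-.
    exact: arc_rel h.
  exists (y %% r); split; [exact: ltn_pmod | | by exists y].
  rewrite (modnD_period (closer_shift ncK)).
  exact: (closerW ncK) h lt_y.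
move=> i i' k lt_i lt_i' _ _ [y [h lt ey]] [y' [h' lt' ey']].
have F := arc_funr ncK.
have [||e|e|e] := @eqmod_lt2 r y y' (etrans ey (esym ey')); try lia.
- by move: h' lt'; rewrite -e => h' lt'; have := F _ _ _ h lt h'; lia.
- move: h; rewrite -(arc_shift ncK) -e => h.
  by have := F _ _ _ h' lt' h; lia.
- move: h'; rewrite -(arc_shift ncK) -e => h'.
  by have := F _ _ _ h lt h'; lia.
Qed.

Lemma n_open_le :
  n_open w r <= n_close w r + \sum_(i < r) (opener d r K i && K i (i + r)).
Proof.
apply: leq_trans (leq_add leq_short_open (leqnn _)).
rewrite n_openE -big_split /=; apply: leq_sum => i _.
by case: opener; case: K.
Qed.

(** For [d = 1] a pair [i], [i + r] is a ball, which cannot open. For [d > 2] the point [i + r]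
    would be paired with both [i] and [i + r + r], which differ modulo [m]. For [d = 2] two
    diameters cross. *)
Lemma n_diameter_le :
  \sum_(i < r) (opener d r K i && K i (i + r)) <= (d == 2).
Proof.
case: (ltngtP d 2) => [lt|gt|e2].
- rewrite leqn0 sum_nat_eq0; apply/forallP => i; apply/implyP => _.
  rewrite eqb0; apply/negP => /andP[/(openerP)[y h] k].
  have d1 : d = 1 by lia.
  have em : m = r by rewrite def_m d1 mul1n.
  have [Km Kc _ _ _] := ncK; have k' : K i i by rewrite -Km em Kc.
  have := relP ncK k' (arc_rel h); have := arc1_lt d1 h; have := arc_lt h; lia.
- rewrite leqn0 sum_nat_eq0; apply/forallP => i; apply/implyP => _.
  rewrite eqb0; apply/negP => /andP[_ k].
  have [_ _ _ _ Kr] := ncK; have := k; rewrite -Kr => k'.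
  rewrite (relC ncK) in k.
  have := relP ncK k k'; rewrite def_m; nia.
have := @leq_sum_rel r 1 (fun i => opener d r K i && K i (i + r)) predT
  (fun _ _ => True).
rewrite big_ord1 e2; apply.
- by move=> i _ _; exists 0.
- have [_ _ _ Kc _] := ncK.
  have X i i' : i < i' -> i' < r -> K i (i + r) -> K i' (i' + r) -> False.
    by move=> h1 h2; apply: (Kc i i' (i + r)); rewrite ?def_m ?e2; lia.
  move=> i i' _ lt lt' /andP[_ k] /andP[_ k'] _ _.
  by case: (ltngtP i i') => // l; exfalso; [apply: X l _ k k' | apply: X l _ k' k].
Qed.

Lemma letter_admissible : admissible d r w.
Proof.
have h1 : n_close w r <= n_open w r by apply: leq_close_open; auto.
have h2 := leq_trans n_open_le (leq_add (leqnn _) n_diameter_le).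
rewrite /admissible; case: eqP => [d1|_]; last by case: (d == 2) h2; lia.
move: h2; rewrite d1 /= => h2; apply/andP; split; last lia.
by apply/forallP => j; apply: leq_close_open; auto; apply: ltnW.
Qed.

End Admissible.

Lemma dvd_rm : r %| m. Proof. by rewrite def_m dvdn_mull. Qed.

Lemma eqmod_rm x y : x = y %[mod m] -> x = y %[mod r].
Proof. by move=> e; rewrite -(modn_dvdm x dvd_rm) e modn_dvdm ?dvd_rm. Qed.

Lemma rel_letter K x y : nc_rel m r K -> K x y -> x <> y %[mod m] ->
  opener d r K x || closer d r K x.
Proof.
move=> ncK k ne; have [x' [y' [ex ey le_r /andP[l1 l2]]]] := eqmod_window x y.
have ex2 := eqmod_rm ex.
rewrite -(modnD_period (opener_shift ncK)) -(modnD_period (closer_shift ncK)) -ex2.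
rewrite (modnD_period (opener_shift ncK)) (modnD_period (closer_shift ncK)).
rewrite -(rel_mod ncK ex ey) in k.
have lt : x' < y'.
  by rewrite ltn_neqAle l1 andbT; apply/eqP => e; apply: ne; rewrite -ex -ey e.
case: (rel_arc ncK k) => [|h|h]; first by rewrite lt.
  by apply/orP; left; apply/openerP; exists y'.
case: (ltnP (x' + m) (y' + r)) => [sh|le].
  apply/orP; right; rewrite -(modnD_period (closer_shift ncK)).
  have -> : x' %% r = (x' + m) %% r by rewrite -modnDmr (eqP dvd_rm) addn0.
  rewrite (modnD_period (closer_shift ncK)).
  exact: (closerW ncK) h sh.
(* The arc from [y'] to [x' + m] has length exactly [r]; shifted by [r], it shows that its far end
   opens. *)
have e : x' + m = y' + r by apply/eqP; rewrite eqn_leq le (arc_le h).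
apply/orP; left; rewrite -(modnD_period (opener_shift ncK)).
have -> : x' %% r = (x' + m) %% r by rewrite -modnDmr (eqP dvd_rm) addn0.
rewrite (modnD_period (opener_shift ncK)) e; apply/openerP; exists (y' + r + r).
by rewrite (arc_shift ncK) -e.
Qed.

(** * Every admissible word comes from a configuration *)

Definition realizes (K : rel nat) (w : letters) :=
  nc_rel m r K /\ forall x, letter K x = w (x %% r).

(** Base case: without closing letters, admissibility leaves at most one opening letter, and only
    for [d = 2]. The blocks are then the balls and at most one diameter. *)
Lemma realizes_diameters w : admissible d r w -> n_close w r = 0 ->
  exists K, realizes K w.
Proof.
move=> adm c0.
have nc x : (w (x %% r) == (false, true)) = false.
  apply/negP => wx; move/eqP: c0; rewrite sum_nat_eq0 => /forallP.
  by move/(_ (Ordinal (ltn_pmod x r_gt0))); rewrite /= wx.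
have op x y : w (x %% r) == (true, false) -> w (y %% r) == (true, false) ->
    d = 2 /\ x = y %[mod r].
  move=> wx wy; have o1 : n_open w r <= (d == 2).
    by move: adm; rewrite /admissible c0; case: (d =P 1) => [->|_] /=; lia.
  have o2 : 0 < n_open w r.
    by rewrite /n_open /count_letter (bigD1 (Ordinal (ltn_pmod x r_gt0))) //= wx.
  have d2 : d = 2 by lia.
  split=> //; apply/eqP/negPn/negP => ne; move: o1; rewrite d2 leqNgt => /negP; apply.
  rewrite /n_open /count_letter (bigD1 (Ordinal (ltn_pmod x r_gt0))) //= wx.
  rewrite (bigD1 (Ordinal (ltn_pmod y r_gt0))) /= ?wy //.
  by rewrite -val_eqE /= eq_sym.
pose K : rel nat := fun x y =>
  (x == y %[mod m]) && (w (x %% r) == (true, true)) ||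
  (w (x %% r) == (true, false)) && (y == x + r %[mod m]).
have m_gt0 : 0 < m by rewrite def_m muln_gt0 d_gt0.
have mr x : (x + m) %% r = x %% r by rewrite -modnDmr (eqP dvd_rm) addn0.
have ncK : nc_rel m r K.
  split.
  - by move=> x y; rewrite /K mr modnDr (addnAC x) modnDr.
  - suff H x y : K x y -> K y x by move=> x y; apply/idP/idP; apply: H.
    case/orP => /andP[].
      by move=> /eqP e wx; rewrite /K e eqxx -(eqmod_rm e) wx.
    move=> wx /eqP e; have [d2 _] := op _ _ wx wx.
    apply/orP; right; rewrite (eqmod_rm e) modnDr wx -modnDml e modnDml -addnA.
    by rewrite addnn -mul2n -d2 -def_m modnDr eqxx.
  - move=> x y z /orP[] /andP[] h1 h2 /orP[] /andP[] h3 h4.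
    + by rewrite -(eqP h1) (eqP h3).
    + by rewrite (eqP h2) in h3.
    + by rewrite (eqP h1) in h4.
    + by rewrite (eqP h2) (eqP h4).
  - move=> x t s u /andP[l1 l2] /andP[l3 l4].
    have [b1 b2] : s < x + r + m /\ x + r < s + m by have := le_rm; lia.
    have [b3 b4] : x < s + m /\ s < x + m by lia.
    have [b5 b6] : t < u + m /\ u < t + m by lia.
    case/orP => /andP[/eqP h1 /eqP h2].
      by have := eqmod_close h1 b3 b4; lia.
    case/orP => /andP[/eqP h3 /eqP h4].
      by have := eqmod_close h3 b5 b6; lia.
    have [_ e] := op _ _ (introT eqP h1) (introT eqP h3).
    have e1 := eqmod_close h2 b1 b2.
    have [b7 b8] : x < t + r /\ t < x + r by clear -l1 l2 e1; lia.
    by have e2 := eqmod_close e b7 b8; rewrite e2 ltnn in l1.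
  - by move=> x y; rewrite /K !modnDr !eqn_modDr.
have ball x : K x x = (w (x %% r) == (true, true)).
  rewrite /K eqxx /=; case: (boolP (w (x %% r) == (true, false))) => [wx|_]; last by rewrite orbF.
  have [d2 _] := op _ _ wx wx; have m2 : m = r + r by rewrite def_m d2 mul2n addnn.
  rewrite (eqP wx) /=; apply/negP => /eqP e.
  by have := @eqmod_close m _ _ e; lia.
have opn x : opener d r K x = (w (x %% r) == (true, false)).
  apply/openerP/idP => [[y h]|wx].
    have := arc_rel h; rewrite /K => /orP[] /andP[] // /eqP e _.
    have := arc_ballF h; have := arc_lt h; have := @eqmod_close m _ _ e; lia.
  have [d2 _] := op _ _ wx wx; exists (x + r).
  by rewrite /arc d2 /= leqnn /K wx eqxx orbT !andbT -addn1 leq_add2l.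
have cls x : closer d r K x = false.
  apply/negP => /closerP[z h lt].
  have l1 := arc_lt h; have l2 := arc_ballF h; have := le_rm.
  have := arc_rel h; rewrite /K => /orP[] /andP[].
    move=> /eqP e _; have := @eqmod_close m _ _ e; lia.
  by move=> _ /eqP e; have := @eqmod_close m _ _ e; lia.
exists K; split=> // x; rewrite /letter opn cls ball.
by case: (w (x %% r)) (nc x) => [[] []].
Qed.

(** Inductive step: the two matched letters are erased, the remaining word is realized by [K'], and
    the pairs [u], [u + s] with [u] congruent to [x0] modulo [r] are added. *)
Lemma realizes_step w x0 s :
  x0 < r -> 0 < s < r -> w x0 = (true, false) -> w ((x0 + s) %% r) = (false, true) ->
  (d = 1 -> x0 + s < r) ->
  (forall t, x0 < t < x0 + s -> w (t %% r) <> (true, false) /\ w (t %% r) <> (false, true)) ->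
  (exists K, realizes K (fun i => if (i == x0) || (i == (x0 + s) %% r)
                         then (false, false) else w i)) ->
  exists K, realizes K w.
Proof.
move=> lt_x0 /andP[s_gt0 lt_s] wx0 wy0 d1s btw [K' [ncK' letK']].
have m_gt0 : 0 < m by rewrite def_m muln_gt0 d_gt0.
have mr x : (x + m) %% r = x %% r by rewrite -modnDmr (eqP dvd_rm) addn0.
have sr x : x <> x + s %[mod r].
  by move=> e; have := @eqmod_close r _ _ e; lia.
pose new u v := (u == x0 %[mod r]) && (v == u + s %[mod m]).
pose K x y := [|| K' x y, new x y | new y x].
have newP u v : new u v -> u = x0 %[mod r] /\ v = u + s %[mod m].
  by case/andP => /eqP e1 /eqP e2; split; [rewrite e1 | ].
have newr u v : new u v -> v = x0 + s %[mod r].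
  by case/newP => e1 /eqmod_rm ->; rewrite -modnDml e1 modnDml.
(* The ends of the new pairs are uncovered in [K'], since their letters were erased. *)
have F0 u v : u = x0 %[mod r] \/ u = x0 + s %[mod r] -> K' u v -> False.
  move=> eu k; have := letK' u.
  have -> : (u %% r == x0) || (u %% r == (x0 + s) %% r) = true.
    by case: eu => ->; rewrite ?eqxx ?orbT // modn_small ?eqxx.
  case: (u %% m =P v %% m) => [e|ne].
    have kk : K' u u by rewrite (rel_mod ncK' (erefl (u %% m)) e).
    by rewrite /letter kk !orbT.
  by have := rel_letter ncK' k ne; rewrite /letter; case: opener => //=; case: closer.
have H1 x z : x = x0 %[mod r] -> K x z -> z = x + s %[mod m].
  move=> ex; case/or3P => [/F0 []|/newP[]//|/newr e]; first by left.
  by have := sr x0; rewrite -ex e.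
have H2 x y z : new z x -> K x y -> y = z %[mod m].
  move=> nzx; have ex := newr _ _ nzx; have [ez exz] := newP _ _ nzx.
  case/or3P => [/F0 []|/newP[e _]|/newP[ey exy]]; first by right.
    by have := sr x0; rewrite -ex e.
  by apply/eqP; rewrite -(eqn_modDr s) -exy exz.
(* Strictly under a new arc there are only balls and uncovered points. A crossing that involves a
   new arc would have an end there, paired with a point outside. *)
have H3 u t z : u = x0 %[mod r] -> u < t < u + s -> K t z -> t = z %[mod m].
  move=> eu /andP[l1 l2]; case/or3P => [k|/newP[e _]|/newr e].
  - apply/eqP/negPn/negP => /eqP ne; have lo := rel_letter ncK' k ne.
    have et : t = x0 + (t - u) %[mod r] by rewrite -modnDml -eu modnDml subnKC // ltnW.
    have [|b1 b2] := btw (x0 + (t - u)); first by clear -l1 l2; lia.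
    rewrite -et in b1 b2.
    have [_ o c] := letterE ncK' t; move: lo; rewrite o c letK'.
    by case: ifP => _ //; case: (w (t %% r)) b1 b2 => [[] []].
  - by have := @eqmod_close r u t (etrans eu (esym e)); lia.
  - have e' : u + s = t %[mod r] by rewrite -modnDml eu modnDml e.
    by have := eqmod_close e'; clear -l1 l2 lt_s; lia.
have nc_in b e : b < e -> e < b + m -> b = e %[mod m] -> False.
  by move=> l1 l2 /(@eqmod_close m); lia.
have Ksym x y : K x y = K y x.
  by have [_ Kc _ _ _] := ncK'; rewrite /K Kc; congr (_ || _); rewrite orbC.
have Km x y : K (x + m) y = K x y.
  by have [Km' _ _ _ _] := ncK'; rewrite /K Km' /new mr modnDr (addnAC x) modnDr.
have le_m := le_rm.
have newE a c : new a c -> a < c -> c < a + m -> c = a + s.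
  by case/newP => _ e l1 l2; apply: (@eqmod_close m) => //; lia.
have newE' a c : new c a -> a < c -> c < a + m -> a + m = c + s.
  by case/newP => _ e l1 l2; apply: (@eqmod_close m); rewrite ?modnDr //; lia.
have ncK : nc_rel m r K.
  split=> //.
  - move=> x y z; case/or3P => [k|n|n] k2.
    + case/or3P: k2 => [k2|n2|n2].
      * by have [_ _ Ku _ _] := ncK'; apply: Ku k k2.
      * by have [e e'] := newP _ _ n2; rewrite e'; apply: H1 => //; rewrite /K k.
      * by apply: H2 n2 _; rewrite /K k.
    + by have [e e'] := newP _ _ n; rewrite e'; apply/esym/H1.
    + by apply/esym; apply: H2 n k2.
  - move=> a b c e /andP[l1 l2] /andP[l3 l4] Kac Kbe.
    case/or3P: (Kac) => [k1|n1|n1].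
    + case/or3P: (Kbe) => [k2|n2|n2].
      * have [_ _ _ Kc _] := ncK'; apply: (Kc a b c e) k1 k2; rewrite ?l1 ?l3 //.
      * have ee : e = b + s by apply: newE n2 _ _; lia.
        apply: (nc_in a c); [lia | lia | apply/esym; apply: (H3 b)].
        - by case: (newP _ _ n2).
        - by rewrite l2 -ee l3.
        - by rewrite Ksym.
      * have ee : b + m = e + s by apply: newE' n2 _ _; lia.
        apply: (nc_in c (a + m)); [lia | lia | apply/esym; apply: (H3 e)].
        - by case: (newP _ _ n2).
        - by rewrite -ee l4 ltn_add2r.
        - by rewrite Km.
    + have ee : c = a + s by apply: newE n1 _ _; lia.
      apply: (nc_in b e); [lia | lia | apply: (H3 a) => //].
      * by case: (newP _ _ n1).
      * by rewrite -ee l1.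
    + have ee : a + m = c + s by apply: newE' n1 _ _; lia.
      apply: (nc_in b e); [lia | lia | apply/esym; apply: (H3 c)].
      * by case: (newP _ _ n1).
      * by rewrite -ee l3.
      * by rewrite Ksym.
  - move=> x y; have [_ _ _ _ Kr] := ncK'.
    by rewrite /K Kr /new !modnDr ![_ + r + s]addnAC !eqn_modDr.
have arcE u v : arc d r K u v = arc d r K' u v || (u == x0 %[mod r]) && (v == u + s).
  apply/idP/orP => [h|[h|/andP[/eqP eu /eqP ->]]].
  - have l1 := arc_lt h; have l2 := arc_ballF h.
    case/or3P: (arc_rel h) => [k|n|n].
    + by left; move: h; rewrite /arc k => /and3P[-> -> _].
    + by right; rewrite (newE _ _ n l1 l2) eqxx andbT; case/andP: n.
    (* A new pair read backwards is not an arc: it would leave its period if [d = 1], and otherwise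
       have length [m - s > r]. *)
    + exfalso; have e := newE' _ _ n l1 l2; case: d_cases => [[d1 em]|[_ lem]].
        move: h; rewrite /arc d1 => /and3P[_ /= /eqP eb _].
        have [ev _] := newP _ _ n; rewrite [x0 %% r]modn_small // in ev.
        have := d1s d1; have := divn_eq u r; have := divn_eq v r.
        rewrite eb ev; lia.
      have := arc_le h; lia.
  - by move: h; rewrite /arc /K => /and3P[-> -> ->].
  - rewrite /arc /K /new eu !eqxx orbT andbT -{1}[u]addn0 ltn_add2l s_gt0 /=.
    case: (d =P 1) => [/d1s lt|_]; last by rewrite leq_add2l ltnW.
    rewrite (divn_eq u r) eu [x0 %% r]modn_small // -addnA !divnMDl //.
    by rewrite eqn_add2l !divn_small.
have openE u : opener d r K u = opener d r K' u || (u == x0 %[mod r]).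
  apply/openerP/orP => [[v]|[/openerP[v h]|e]].
  - by rewrite arcE => /orP[h|/andP[-> _]]; [left; apply/openerP; exists v | right].
  - by exists v; rewrite arcE h.
  - by exists (u + s); rewrite arcE e eqxx orbT.
have closeE v : closer d r K v = closer d r K' v || (v == x0 + s %[mod r]).
  apply/closerP/orP => [[u]|[/closerP[u h l]|/eqP e]].
  - rewrite arcE => /orP[h l|/andP[/eqP eu /eqP ev] l].
      by left; apply/closerP; exists u.
    by right; rewrite -(modnDr v r) ev -modnDml eu modnDml.
  - by exists u => //; rewrite arcE h.
  - exists (v + r - s); last lia.
    have -> : arc d r K (v + r - s) (v + r) = arc d r K (v + r - s) (v + r - s + s).
      by congr arc; lia.
    rewrite arcE eqxx andbT -(eqn_modDr s) subnK ?modnDr ?e ?eqxx ?orbT //; lia.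
have ballE x : K x x = K' x x.
  rewrite /K; have -> : new x x = false; last by rewrite !orbF.
  by apply/negP => /newP[_ /(@eqmod_close m)]; lia.
exists K; split=> // x; have := letK' x; rewrite /letter openE closeE ballE.
case: (x %% r =P x0 %% r) => [e|ne].
  rewrite e [x0 %% r]modn_small //= eqxx /= wx0.
  have -> : (x0 == (x0 + s) %% r) = false.
    by apply/negP => /eqP e'; apply: (sr x0); rewrite -e' modn_small.
  by case: opener => //; case: closer => //; case: (K' x x).
case: (x %% r =P (x0 + s) %% r) => [e|ne'].
  rewrite e orbT wy0.
  by case: opener => //; case: closer => //; case: (K' x x).
rewrite !orbF => ->; rewrite ifF //; apply/negP => /eqP e.
by apply: ne; rewrite e [x0 %% r]modn_small.
Qed.

Lemma count_letterS w c j : count_letter w c j.+1 = count_letter w c j + (w j == c).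
Proof. exact: big_ord_recr. Qed.

Lemma count_letter_gt0 w c j : 0 < count_letter w c j -> exists2 i, i < j & w i = c.
Proof.
elim: j => [|j IH]; first by rewrite /count_letter big_ord0.
rewrite count_letterS; case: eqP => [wj|_]; first by exists j.
by rewrite addn0 => /IH[i lt wi]; exists i => //; apply: ltnW.
Qed.

Lemma leq_count_letter w c i j : i <= j -> count_letter w c i <= count_letter w c j.
Proof.
move/subnKC <-; elim: (j - i) => [|k IH]; first by rewrite addn0.
by rewrite addnS count_letterS (leq_trans IH) ?leq_addr.
Qed.

Lemma count_letter_const w c i j : i <= j ->
  (forall k, i <= k < j -> w k <> c) -> count_letter w c j = count_letter w c i.
Proof.
move/subnKC <-; elim: (j - i) => [|k IH] nc; first by rewrite addn0.
rewrite addnS count_letterS IH => [|l /andP[l1 l2]]; last by apply: nc; lia.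
by case: eqP => [e|_]; [case: (nc (i + k)) => //; lia | rewrite addn0].
Qed.

Lemma count_letter_erase w c x y j : x != y -> c != (false, false) ->
  count_letter (fun i => if (i == x) || (i == y) then (false, false) else w i) c j
    + (w x == c) * (x < j) + (w y == c) * (y < j) = count_letter w c j.
Proof.
move=> ne nc; elim: j => [|j IH].
  by rewrite /count_letter !big_ord0 !ltn0 !muln0.
rewrite !count_letterS -IH !ltnS (leq_eqVlt x) (leq_eqVlt y) (eq_sym x j) (eq_sym y j).
case: (j =P x) => [->|nx] /=.
  by rewrite ltnn (negbTE ne) eq_sym (negbTE nc) /=; lia.
case: (j =P y) => [->|ny] /=; last by lia.
by rewrite ltnn eq_sym (negbTE nc) /=; lia.
Qed.

(** From an opening letter followed by a closing one, pass to the first closing letter [y2] after it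
    and then to the last opening letter [x2] before [y2]. *)
Lemma adjacent_letters w : admissible d r w -> 0 < n_close w r ->
  exists x s, [/\ x < r, 0 < s < r, w x = (true, false), w ((x + s) %% r) = (false, true)
    & (d = 1 -> x + s < r) /\
      forall t, x < t < x + s -> w (t %% r) <> (true, false) /\ w (t %% r) <> (false, true)].
Proof.
move=> adm c0.
have [x1 [y1 [/andP[xy1 xy1'] wx1 wy1 [lt_x1 d1y]]]] : exists x1 y1, [/\ x1 < y1 < x1 + r,
    w (x1 %% r) = (true, false), w (y1 %% r) = (false, true) & x1 < r /\ (d = 1 -> y1 < r)].
  have [y lt_y wy] := count_letter_gt0 c0.
  move: adm; rewrite /admissible; case: eqP => [d1 /andP[/forallP pre /eqP eoc]|nd adm].
    (* For [d = 1] the ballot condition on the prefix ending at [y] yields an opening letter before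
       [y]. *)
    have le : n_close w y.+1 <= n_open w y.+1.
      move: lt_y; rewrite leq_eqVlt => /orP[/eqP ->|lt]; first by rewrite eoc.
      exact: (pre (Ordinal lt)).
    have [x lt_x wx] : exists2 x, x < y.+1 & w x = (true, false).
      apply: count_letter_gt0; apply: leq_trans le.
      by rewrite /n_close count_letterS wy eqxx addn1.
    have ne : x != y by apply: contra_eqN wx => /eqP ->; rewrite wy.
    by exists x, y; rewrite !modn_small //; last (by lia); split=> //; lia.
  have [x lt_x wx] : exists2 x, x < r & w x = (true, false).
    apply: count_letter_gt0; apply: leq_trans c0 _.
    by rewrite -/(n_open w r); case/orP: adm => [/eqP ->|/andP[_ /eqP ->]].
  case: (ltngtP x y) => lt; last by rewrite lt wy in wx.
    by exists x, y; rewrite !modn_small //; split=> //; lia.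
  (* The closing letter comes first, so its copy in the next period is used. *)
  by exists x, (y + r); rewrite modnDr !modn_small //; split=> //; lia.
pose p y := (x1 < y) && (w (y %% r) == (false, true)).
have exy : exists y, p y by exists y1; rewrite /p xy1 wy1 eqxx.
have [y2 /andP[xy2 /eqP wy2] min] := ex_minnP exy.
have le_y : y2 <= y1 by apply: min; rewrite /p xy1 wy1 eqxx.
pose q x := (x < y2) && (w (x %% r) == (true, false)).
have exx : exists x, q x by exists x1; rewrite /q xy2 wx1 eqxx.
have [x2 /andP[lt_x2 /eqP wx2] max] := @ex_maxnP q y2 exx (fun x h => ltnW (proj1 (andP h))).
have le_x : x1 <= x2 by apply: max; rewrite /q xy2 wx1 eqxx.
have ex2 := divn_eq x2 r; have x2r := ltn_pmod x2 r_gt0.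
have e k : x2 %% r + k = x2 + k %[mod r] by rewrite modnDml.
(* Since [x2] may lie in the second period, it is reduced modulo [r]; the distance to [y2] is
   kept. *)
exists (x2 %% r), (y2 - x2); split=> //.
- lia.
- by rewrite e subnKC // ltnW.
split=> [d1|t /andP[l1 l2]].
  by have := d1y d1; have := leq_mod x2 r; move: lt_x2 le_y; clear; lia.
have et : t %% r = (t + (x2 - x2 %% r)) %% r.
  have -> : x2 - x2 %% r = x2 %/ r * r by rewrite {1}ex2 addnK.
  by rewrite addnC modnMDl.
rewrite et; set t' := t + _.
have [b1 b2] : x2 < t' /\ t' < y2.
  move: l1 l2 (leq_mod x2 r) lt_x2; rewrite /t'; clear.
  by generalize (x2 %% r) => k; lia.
split=> /eqP wt.
  by have := max t'; rewrite /q wt b2 => /(_ isT); rewrite leqNgt b1.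
have := min t'; rewrite /p wt (leq_ltn_trans le_x b1) => /(_ isT).
by rewrite leqNgt b2.
Qed.

Lemma realizable w : admissible d r w -> exists K, realizes K w.
Proof.
have [n] := ubnP (n_close w r); elim: n w => // n IHn w lt_n adm.
have [c0|c_gt0] := posnP (n_close w r); first exact: realizes_diameters.
have [x [s [lt_x /andP[s0 lt_s] wx wy [d1s btw]]]] := adjacent_letters adm c_gt0.
apply: (@realizes_step w x s) => //; first by rewrite s0.
set y := (x + s) %% r in wy *; have ne : x != y.
  by apply: contra_eqN wx => /eqP ->; rewrite wy.
have lt_y : y < r by rewrite ltn_pmod.
pose w' : letters := fun i => if (i == x) || (i == y) then (false, false) else w i.
change (exists K, realizes K w').
have eo j : n_open w' j + (x < j) = n_open w j.
  have := @count_letter_erase w (true, false) x y j ne isT.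
  by rewrite wx wy eqxx mul1n mul0n addn0.
have ec j : n_close w' j + (y < j) = n_close w j.
  have := @count_letter_erase w (false, true) x y j ne isT.
  by rewrite wx wy eqxx mul1n mul0n addn0.
have := eo r; have := ec r; rewrite lt_x lt_y => ecr eor.
apply: IHn; first lia.
move: adm; rewrite /admissible; case: eqP => [d1 /andP[/forallP pre e]|_].
  apply/andP; split; last lia.
  apply/forallP => j; have := pre j; rewrite -eo -ec.
  have ey : y = x + s by rewrite /y modn_small // d1s.
  case: (ltnP x j) => l1; case: (ltnP y j) => l2; try lia.
  (* A prefix ending between [x] and [y] loses only its opening letter. It stays balanced because no
     letter closes between [x] and [j], so the inequality at [x] leaves one to spare at [j]. *)
  have e1 : n_close w j = n_close w x.
    apply: count_letter_const => [|k /andP[]]; first exact: ltnW.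
    rewrite leq_eqVlt => /orP[/eqP <- _|l3 l4]; first by rewrite wx.
    have [|_] := btw k; first by lia.
    by rewrite modn_small // (ltn_trans l4).
  have e2 : n_open w x < n_open w j.
    apply: leq_trans (leq_count_letter _ _ l1).
    by rewrite count_letterS wx eqxx addn1.
  have := pre (Ordinal lt_x); rewrite /= -e1 => e3 _.
  have := eo j; have := ec j; rewrite l1 ltnNge l2 /=; lia.
lia.
Qed.

End NoncrossingRel.

(** * Counting admissible words *)

Lemma card_tupleS (T : finType) n (P : pred (seq T)) :
  #|[set t : n.+1.-tuple T | P t]| = \sum_(x : T) #|[set t : n.-tuple T | P (x :: t)]|.
Proof.
rewrite -sum1_card (reindex (fun p : T * n.-tuple T => [tuple of p.1 :: p.2])) /=.
  rewrite (eq_bigl (fun p : T * n.-tuple T => P (p.1 :: p.2))) => [|p]; last by rewrite inE.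
  rewrite -(pair_big_dep predT (fun x (t : n.-tuple T) => P (x :: t)) (fun _ _ => 1)) /=.
  by apply: eq_bigr => x _; rewrite -sum1_card; apply: eq_bigl => t; rewrite inE.
exists (fun t => (thead t, behead_tuple t)) => [[x t] _|t _] /=.
  by congr (_, _); apply: val_inj.
by rewrite -tuple_eta.
Qed.

Lemma card_tuple0 (T : finType) (P : pred (seq T)) :
  #|[set t : 0.-tuple T | P t]| = P [::].
Proof.
case e: (P [::]); last first.
  by apply: eq_card0 => t; rewrite inE tuple0 e.
by rewrite /= -(expn0 #|T|) -card_tuple; apply: eq_card => t; rewrite !inE tuple0 e.
Qed.

Lemma sum_bool_pair (F : bool * bool -> nat) :
  \sum_x F x = F (true, true) + F (true, false) + F (false, true) + F (false, false).
Proof.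
transitivity (\sum_(p : bool * bool) F (p.1, p.2)); first by apply: eq_bigr => -[].
by rewrite -(pair_bigA _ (fun b c => F (b, c))) /= !big_bool /= addnA.
Qed.

Lemma count_letter_cons c l s j :
  count_letter (nth (false, false) (l :: s)) c j.+1 =
  (l == c) + count_letter (nth (false, false) s) c j.
Proof. exact: big_ord_recl. Qed.

(** Negating the second bit turns a word of length [r] into a subset of [2 * r] points; [weight] is
    its size, which equals [r] plus the excess of opening over closing letters. *)
Definition weight (s : seq (bool * bool)) := sumn [seq l.1 + ~~ l.2 | l : bool * bool <- s].

Lemma weightE s : let w := nth (false, false) s in
  n_open w (size s) + size s = n_close w (size s) + weight s.
Proof.
elim: s => [|l s IH] /=; first by rewrite /n_open /n_close /count_letter !big_ord0.
move: IH; rewrite /n_open /n_close !count_letter_cons /weight /=.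
by case: l => [[] []] /=; lia.
Qed.

Lemma card_weight r k : #|[set t : r.-tuple (bool * bool) | weight t == k]| = 'C(2 * r, k).
Proof.
elim: r k => [|r IH] k.
  by rewrite muln0 bin0n (card_tuple0 (fun s => weight s == k)) eq_sym.
rewrite (card_tupleS _ (fun s => weight s == k)) sum_bool_pair.
have wc l s : weight (l :: s) = l.1 + ~~ l.2 + weight s by [].
have e l : #|[set t : r.-tuple (bool * bool) | weight (l :: t) == k]| =
    (l.1 + ~~ l.2 <= k) * 'C(2 * r, k - (l.1 + ~~ l.2)).
  case: leqP => h; last first.
    rewrite mul0n; apply: eq_card0 => t; rewrite inE wc; apply/negP => /eqP ek.
    by move: h; rewrite -ek ltnNge leq_addr.
  rewrite mul1n -IH; apply: eq_card => t; rewrite !inE wc.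
  by rewrite -{1}(subnKC h) eqn_add2l.
have e1 : _ = (1 <= k) * 'C(2 * r, k - 1) := e (true, true).
have e2 : _ = (2 <= k) * 'C(2 * r, k - 2) := e (true, false).
have e3 : _ = (0 <= k) * 'C(2 * r, k - 0) := e (false, true).
have e4 : _ = (1 <= k) * 'C(2 * r, k - 1) := e (false, false).
rewrite e1 e2 e3 ?e4 mulnS add2n {e1 e2 e3 e4 e wc}; case: k => [|[|k]].
- by rewrite !bin0.
- by rewrite !bin1 !bin0; lia.
- by rewrite !binS !subSS !subn0 /=; lia.
Qed.

(** Motzkin paths from height [h] to 0 whose level steps have two colours. *)
Fixpoint dyck (h : nat) (s : seq (bool * bool)) : bool :=
  match s with
  | [::] => h == 0
  | (true, false) :: s' => dyck h.+1 s'
  | (false, true) :: s' => (0 < h) && dyck h.-1 s'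
  | _ :: s' => dyck h s'
  end.

Definition ballot h (w : letters) n : Prop :=
  (forall j, j <= n -> n_close w j <= h + n_open w j) /\ h + n_open w n = n_close w n.

Lemma ballot_cons h h' l s :
  l != (false, true) \/ 0 < h ->
  h' + (l == (false, true)) = h + (l == (true, false)) ->
  ballot h' (nth (false, false) s) (size s) <->
  ballot h (nth (false, false) (l :: s)) (size s).+1.
Proof.
rewrite /ballot /n_open /n_close !count_letter_cons => hl eh.
split=> [[H e]|[H e]]; split; try lia.
  case=> [|j] lt; first by rewrite /count_letter !big_ord0.
  by rewrite !count_letter_cons; have := H _ lt; lia.
by move=> j lt; have := H j.+1 lt; rewrite !count_letter_cons; lia.
Qed.

Lemma dyckP h s : reflect (ballot h (nth (false, false) s) (size s)) (dyck h s).
Proof.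
elim: s h => [|l s IH] h.
  rewrite /ballot /n_open /n_close /count_letter.
  apply: (iffP eqP) => [->|[_]]; rewrite /= ?big_ord0 ?addn0 //.
  by split=> // j; rewrite leqn0 => /eqP ->; rewrite !big_ord0.
case: l => [[] []].
- by apply: (equivP (IH h)); apply: ballot_cons => //; left.
- by apply: (equivP (IH h.+1)); apply: ballot_cons => /=; [left | lia].
- case: (posnP h) => [h0|h_gt0] /=; last first.
    by rewrite h_gt0; apply: (equivP (IH h.-1)); apply: ballot_cons => /=; [right | lia].
  rewrite h0 /=; constructor => -[/(_ 1 isT)].
  by rewrite /n_open /n_close !count_letter_cons /count_letter !big_ord0.
- by apply: (equivP (IH h)); apply: ballot_cons => //; left.
Qed.

(** The difference of binomials of the reflection principle, written additively. Splitting off the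
    first letter matches two applications of Pascal's rule. *)
Lemma card_dyck r h :
  #|[set t : r.-tuple (bool * bool) | dyck h t]| + 'C(r.*2.+1, r + h + 2) =
  'C(r.*2.+1, r + h + 1).
Proof.
elim: r h => [|r IH] h.
  rewrite (card_tuple0 (dyck h)); case: h => [|h] //.
  by rewrite !bin_small //=; lia.
rewrite (card_tupleS _ (dyck h)) sum_bool_pair /=.
pose T k := #|[set t : r.-tuple (bool * bool) | dyck k t]|.
pose T' := #|[set t : r.-tuple (bool * bool) | (0 < h) && dyck h.-1 t]|.
rewrite -/T' -/(T h) -/(T h.+1).
have e0 := IH h; have e1 := IH h.+1; rewrite -/(T _) in e0; rewrite -/(T _) in e1.
(* At [h = 0] no path can step down, and the two binomials agree by symmetry. *)
have e2 : T' + 'C(r.*2.+1, r + h + 1) = 'C(r.*2.+1, r + h).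
  rewrite /T'.
  case: h {e0 e1 T'} => [|h]; last first.
    rewrite -(eqP (_ : r + h + 1 == r + h.+1)); last by lia.
    by rewrite -(IH h); congr (_ + 'C(_, _)); lia.
  rewrite eq_card0 => [|t]; last by rewrite !inE.
  by rewrite add0n !addn0 addn1 -[RHS]bin_sub ?leqW -?addnn ?leq_addr // -addnS addKn.
rewrite doubleS; move: e0 e1 e2; set N := r.*2.+1; clearbody N T T' => e0 e1 e2.
have -> : r.+1 + h + 2 = (r + h + 1).+2 by lia.
have -> : r.+1 + h + 1 = (r + h).+2 by lia.
rewrite !binS -e2; move: e0 e1.
have -> : r + h.+1 + 2 = (r + h + 1).+2 by lia.
have -> : r + h.+1 + 1 = (r + h + 1).+1 by lia.
have -> : r + h + 2 = (r + h + 1).+1 by lia.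
have -> : (r + h).+1 = r + h + 1 by lia.
lia.
Qed.

Section CountAdmissible.

Variables (r : nat).
Hypothesis r_gt0 : 0 < r.

Let A d := [set t : r.-tuple (bool * bool) | admissible d r (nth (false, false) t)].

Lemma card_admissible1 : #|A 1| + 'C(r.*2.+1, r + 2) = 'C(r.*2.+1, r + 1).
Proof.
have := card_dyck r 0; rewrite addn0 => <-; congr (_ + _); apply: eq_card => t.
rewrite !inE /admissible /=; apply/idP/dyckP; rewrite size_tuple.
  move=> /andP[/forallP H /eqP e]; split=> // j; rewrite leq_eqVlt => /orP[/eqP ->|lt].
    by rewrite add0n e.
  exact: (H (Ordinal lt)).
case=> H e; rewrite -e eqxx andbT; apply/forallP => j; apply: H; exact: ltnW.
Qed.

(** Balanced words have weight [r], those with one extra opening letter weight [r.+1]; Pascal's rule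
    adds the two counts. *)
Lemma card_admissible2 : #|A 2| = 'C(r.*2.+1, r.+1).
Proof.
rewrite binS -mul2n -!card_weight addnC -cardsUI.
rewrite (_ : _ :&: _ = set0) ?cards0 ?addn0; last first.
  by apply/setP => t; rewrite !inE; apply/negbTE/negP => /andP[/eqP -> /eqP]; lia.
apply: eq_card => t; rewrite !inE /admissible /=.
have := weightE t; rewrite size_tuple /=; lia.
Qed.

Lemma card_admissible3 d : 2 < d -> #|A d| = 'C(r.*2, r).
Proof.
move=> d_gt2; rewrite -mul2n -card_weight; apply: eq_card => t.
rewrite !inE /admissible (gtn_eqF d_gt2) (gtn_eqF (ltnW d_gt2)) orbF.
have := weightE t; rewrite size_tuple /=; lia.
Qed.

End CountAdmissible.

(** * Configurations as relations *)

Section Configurations.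

Variable p : nat.
Let m := p.+1.
Implicit Types (F : {set {set 'I_m}}) (K : rel nat).

Definition pair_rel F : rel nat := fun x y => [set inZp x; inZp y] \in F.

Definition rotate (k : nat) F : {set {set 'I_m}} :=
  [set (cshift m ^+ k)%g @: (A : {set 'I_m}) | A in F].

Definition config_of K : {set {set 'I_m}} :=
  [set A | [exists i : 'I_m, exists j : 'I_m, K i j && (A == [set i; j])]].

Lemma eq_inZp x y : (inZp x == inZp y :> 'I_m) = (x == y %[mod m]).
Proof. by rewrite -val_eqE. Qed.

Lemma set2_eq (T : finType) (a b x y : T) : [set a; b] = [set x; y] ->
  a = x /\ b = y \/ a = y /\ b = x.
Proof.
move=> e; have ha : a \in [set x; y] by rewrite -e set21.
have hb : b \in [set x; y] by rewrite -e set22.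
have hx : x \in [set a; b] by rewrite e set21.
have hy : y \in [set a; b] by rewrite e set22.
move: ha hb hx hy; rewrite !inE.
by do 4![case/orP => /eqP ?]; subst; auto.
Qed.

Lemma pair_rel_config F : (forall A, A \in F -> is_ball A || is_arc A) ->
  config_of (pair_rel F) = F.
Proof.
move=> cF; apply/setP => A; rewrite inE; apply/existsP/idP => [[i /existsP[j]]|AF].
  by rewrite /pair_rel !valZpK => /andP[h /eqP ->].
have [i [j e]] : exists i j, A = [set i; j].
  have := cF _ AF; rewrite /is_ball /is_arc => /orP[/cards1P[i ->]|/cards2P[i [j [_ ->]]]].
    by exists i, i; rewrite setUid.
  by exists i, j.
by exists i; apply/existsP; exists j; rewrite /pair_rel !valZpK -e AF eqxx.
Qed.

Lemma config_blocks F A : F \in nc_configurations m -> A \in F -> is_ball A || is_arc A.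
Proof. by rewrite inE => /andP[/andP[/forall_inP cF _] _]; apply: cF. Qed.

Lemma pair_rel_inj F F' : F \in nc_configurations m -> F' \in nc_configurations m ->
  pair_rel F =2 pair_rel F' -> F = F'.
Proof.
move=> ncF ncF' e; rewrite -(pair_rel_config (@config_blocks _ ^~ ncF)).
rewrite -(pair_rel_config (@config_blocks _ ^~ ncF')); apply/setP => A; rewrite !inE.
by apply: eq_existsb => i; apply: eq_existsb => j; rewrite e.
Qed.

Lemma pair_rel_mod F x x' y y' : x = x' %[mod m] -> y = y' %[mod m] ->
  pair_rel F x y = pair_rel F x' y'.
Proof.
move=> ex ey; rewrite /pair_rel.
have -> : inZp x = inZp x' :> 'I_m by apply/eqP; rewrite eq_inZp ex.
by have -> : inZp y = inZp y' :> 'I_m by apply/eqP; rewrite eq_inZp ey.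
Qed.

(** Crossings are defined for the linear order, whereas [nc_rel] is cyclic. After moving [x] below
    [m], the number of the points [t], [s], [u] beyond [m] decides which cyclic rotation of the four
    is a linear crossing. *)
Lemma config_rel F r : F \in nc_configurations m ->
  (forall x y, pair_rel F (x + r) (y + r) = pair_rel F x y) ->
  nc_rel m r (pair_rel F).
Proof.
rewrite inE => /andP[/andP[_ /trivIsetP tF] ncF] rF.
have sym x y : pair_rel F x y = pair_rel F y x by rewrite /pair_rel setUC.
have lin i1 j1 i2 j2 : i1 < j1 -> j1 < i2 -> i2 < j2 -> j2 < m ->
    pair_rel F i1 i2 -> pair_rel F j1 j2 -> False.
  move=> l1 l2 l3 l4 h1 h2; case/negP: ncF.
  have val_in k : k < m -> (inZp k : 'I_m) = k :> nat by move=> l; apply: modn_small.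
  apply/existsP; exists (inZp i1); apply/existsP; exists (inZp i2).
  apply/existsP; exists (inZp j1); apply/existsP; exists (inZp j2).
  by apply/and5P; split=> //; rewrite !val_in //; lia.
split=> //.
- by move=> x y; apply: pair_rel_mod => //; rewrite modnDr.
- move=> x y z h1 h2; apply/eqP; rewrite -eq_inZp.
  have e : [set inZp x; inZp y] = [set inZp x; inZp z] :> {set 'I_m}.
    apply/eqP/negPn/negP => ne; have := tF _ _ h1 h2 ne.
    by move/disjointFr => /(_ (inZp x)); rewrite !inE eqxx => /(_ isT).
  by apply/eqP; case: (set2_eq e) => -[// -> ->].
- move=> x t s u; wlog lt_x : x t s u / x < m.
    move=> H l1 l2 h1 h2; pose q := x %/ m * m.
    have ex := divn_eq x m; have eq y : q <= y -> y = y - q %[mod m].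
      by move=> l; rewrite -{1}(subnK l) addnC modnMDl.
    apply: (H (x - q) (t - q) (s - q) (u - q)).
    - by rewrite /q {1}ex addKn ltn_pmod.
    - rewrite /q; lia.
    - rewrite /q; lia.
    - by rewrite -(@pair_rel_mod F x _ s _) //; apply: eq; rewrite /q; lia.
    - by rewrite -(@pair_rel_mod F t _ u _) //; apply: eq; rewrite /q; lia.
  move=> /andP[l1 l2] /andP[l3 l4] h1 h2.
  have sub y : m <= y -> y = y - m %[mod m] by move=> l; rewrite -{1}(subnK l) modnDr.
  case: (ltnP u m) => lu; first by apply: (lin x t s u).
  have h2' : pair_rel F t (u - m) by rewrite -(@pair_rel_mod F t t u) // sub.
  case: (ltnP s m) => ls.
    by apply: (lin (u - m) x t s) => //; rewrite 1?sym //; lia.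
  have h1' : pair_rel F x (s - m) by rewrite -(@pair_rel_mod F x x s) // sub.
  case: (ltnP t m) => lt.
    by apply: (lin (s - m) (u - m) x t) => //; rewrite 1?sym //; lia.
  have h3 : pair_rel F (t - m) (u - m) by rewrite -(@pair_rel_mod F t _ (u - m) (u - m)) // sub.
  by apply: (lin (t - m) (s - m) (u - m) x) => //; rewrite 1?sym //; lia.
Qed.

Lemma pair_rel_config_of K r : nc_rel m r K -> pair_rel (config_of K) =2 K.
Proof.
move=> ncK x y; have mod_in z : (inZp z : 'I_m) = z %[mod m] by rewrite /= modn_mod.
have eK := rel_mod ncK (mod_in x) (mod_in y).
rewrite /pair_rel inE; apply/existsP/idP => [[i /existsP[j /andP[k /eqP e]]]|k].
  rewrite -eK; case: (set2_eq e) => -[-> ->] //.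
  by rewrite (relC ncK).
by exists (inZp x); apply/existsP; exists (inZp y); rewrite eK k eqxx.
Qed.

Lemma config_of_nc K r : nc_rel m r K -> config_of K \in nc_configurations m.
Proof.
move=> ncK; have mem A : A \in config_of K -> exists i j : 'I_m, K i j /\ A = [set i; j].
  by rewrite inE => /existsP[i /existsP[j /andP[k /eqP ->]]]; exists i, j.
rewrite inE; apply/andP; split; [apply/andP; split|].
- apply/forall_inP => A /mem[i [j [_ ->]]].
  by rewrite /is_ball /is_arc cards2; case: (i != j).
- have [_ _ Ku _ _] := ncK.
  have mem' A x : A \in config_of K -> x \in A -> exists2 y : 'I_m, K x y & A = [set x; y].
    move=> /mem[i [j [k ->]]]; rewrite !inE => /orP[] /eqP ->; first by exists j.
    by exists i; [rewrite (relC ncK) | rewrite setUC].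
  apply/trivIsetP => A B FA FB; apply: contraR => /pred0Pn[x /= /andP[xA xB]].
  have [y ky ->] := mem' _ _ FA xA; have [z kz ->] := mem' _ _ FB xB.
  have := Ku _ _ _ ky kz; rewrite !modn_small // => /ord_inj ->; exact: eqxx.
apply/negP => /existsP[i1 /existsP[i2 /existsP[j1 /existsP[j2]]]].
have E := pair_rel_config_of ncK.
move=> /and5P[h1 h2 l1 l2 l3]; have [_ _ _ Kc _] := ncK.
apply: (Kc i1 j1 i2 j2); first by rewrite l1.
- by rewrite l3 /= (leq_trans (ltn_ord j2)) ?leq_addl.
- by rewrite -E /pair_rel !valZpK.
- by rewrite -E /pair_rel !valZpK.
Qed.

Lemma cshift_inZp k x : (cshift m ^+ k)%g (inZp x) = inZp (x + k).
Proof. by apply: val_inj; rewrite /= cshiftX /= modnDml. Qed.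

Lemma pair_rel_rotate k F x y : pair_rel (rotate k F) (x + k) (y + k) = pair_rel F x y.
Proof.
rewrite /pair_rel -!cshift_inZp.
have -> : [set (cshift m ^+ k)%g (inZp x); (cshift m ^+ k)%g (inZp y)] =
    (cshift m ^+ k)%g @: [set inZp x; inZp y] by rewrite imsetU !imset_set1.
by rewrite mem_imset //; apply/imset_inj/perm_inj.
Qed.

Lemma rotate_back k z : z + (m - k %% m) + k = z %[mod m].
Proof.
by rewrite -modnDmr -addnA subnK ?modnDr // ltnW // ltn_pmod.
Qed.

Lemma pair_rel_rotateV k F x y :
  pair_rel (rotate k F) x y = pair_rel F (x + (m - k %% m)) (y + (m - k %% m)).
Proof.
by rewrite -(pair_rel_mod _ (rotate_back k x) (rotate_back k y)) pair_rel_rotate.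
Qed.

Lemma rotate_nc k F : F \in nc_configurations m -> rotate k F \in nc_configurations m.
Proof.
move=> ncF; have blocks A : A \in rotate k F -> is_ball A || is_arc A.
  move=> /imsetP[B FB ->]; rewrite /is_ball /is_arc card_imset; last exact: perm_inj.
  exact: config_blocks ncF FB.
rewrite -(pair_rel_config blocks); apply: (@config_of_nc _ m).
have [|Km Kc Ku Kx Kr] := @config_rel F m ncF.
  by move=> x y; apply: pair_rel_mod; rewrite modnDr.
set c := m - k %% m; have E := pair_rel_rotateV k F; rewrite -/c in E.
split=> [x y|x y|x y z|x t s u|x y]; rewrite ?E.
- by rewrite addnAC Km.
- by rewrite Kc.
- by move=> h1 h2; apply/eqP; rewrite -(eqn_modDr c); apply/eqP; apply: Ku h1 h2.
- move=> /andP[l1 l2] /andP[l3 l4]; apply: Kx; first by rewrite !ltn_add2r l1.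
  by rewrite ltn_add2r l3 addnAC ltn_add2r.
- by rewrite ![_ + m + _]addnAC Kr.
Qed.

Lemma rotate_fixedP k F : F \in nc_configurations m ->
  reflect (forall x y, pair_rel F (x + k) (y + k) = pair_rel F x y) (rotate k F == F).
Proof.
move=> ncF; apply: (iffP eqP) => [e x y|H].
  by rewrite -{1}e pair_rel_rotate.
apply: pair_rel_inj (rotate_nc k ncF) ncF _ => x y.
by rewrite pair_rel_rotateV -H; apply: pair_rel_mod; apply: rotate_back.
Qed.

(** By Bezout, [gcdn m k] plus a multiple of [k] is a multiple of [m], under which [pair_rel F] is
    invariant. *)
Lemma rotate_fixed_gcd k F : F \in nc_configurations m ->
  (rotate (gcdn m k) F == F) = (rotate k F == F).
Proof.
move=> ncF; set K := pair_rel F.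
have mul a n : (forall x y, K (x + a) (y + a) = K x y) ->
    forall x y, K (x + n * a) (y + n * a) = K x y.
  by move=> H; elim: n => [|n IH] x y; rewrite ?addn0 // mulSn !addnA IH H.
apply/(rotate_fixedP _ ncF)/(rotate_fixedP _ ncF) => H; rewrite -/K in H *.
  by have /dvdnP[q ->] := dvdn_gcdr m k; apply: mul.
have [a _ /dvdnP[q e]] := @Bezoutl m k isT => x y.
rewrite -(mul _ a H) -!addnA e; apply: pair_rel_mod; by rewrite addnC modnMDl.
Qed.

Lemma eq_admissible d r (w w' : letters) : (forall i, i < r -> w i = w' i) ->
  admissible d r w = admissible d r w'.
Proof.
move=> e; have ec c j : j <= r -> count_letter w c j = count_letter w' c j.
  by move=> le; apply: eq_bigr => i _; rewrite e // (leq_trans (ltn_ord i)).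
rewrite /admissible /n_open /n_close !ec //; congr (if _ then _ && _ else _).
by apply: eq_forallb => j; rewrite !ec // ltnW.
Qed.

(** The map [f] reads off the word of one period: it is injective by [letter_inj], and its image is
    given by [letter_admissible] and [realizable]. *)
Lemma card_rotate_fixed k (r := gcdn m k) (d := m %/ r) :
  #|[set F in nc_configurations m | rotate k F == F]| =
  #|[set t : r.-tuple (bool * bool) | admissible d r (nth (false, false) t)]|.
Proof.
have r_gt0 : 0 < r by rewrite gcdn_gt0.
have def_m : m = d * r by rewrite /d divnK // dvdn_gcdl.
have d_gt0 : 0 < d by case: d def_m.
pose f F := [tuple letter d r (pair_rel F) i | i < r].
have ncX F : F \in nc_configurations m -> rotate k F == F -> nc_rel m r (pair_rel F).
  move=> ncF; rewrite -rotate_fixed_gcd // => /(rotate_fixedP _ ncF).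
  exact: config_rel.
have nth_f F i : i < r -> nth (false, false) (f F) i = letter d r (pair_rel F) i.
  move=> lt; have := tnth_mktuple (fun j : 'I_r => letter d r (pair_rel F) j) (Ordinal lt).
  by rewrite (tnth_nth (false, false)).
rewrite -(@card_in_imset _ _ f) => [|F F']; last first.
  move=> /setIdP[ncF xF] /setIdP[ncF' xF'] e.
  apply: pair_rel_inj => //; apply: (letter_inj d_gt0 r_gt0 def_m (ncX _ ncF xF)) => [|i lt].
    exact: ncX.
  by rewrite -!nth_f // e.
apply: eq_card => t; rewrite inE; apply/imsetP/idP => [[F]|adm].
  move=> /setIdP[ncF xF] ->.
  have := letter_admissible d_gt0 r_gt0 def_m (ncX _ ncF xF).
  by rewrite (@eq_admissible _ _ _ (nth (false, false) (f F))) // => i /nth_f ->.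
have [K [ncK e]] := realizable d_gt0 r_gt0 def_m adm.
have ncF := config_of_nc ncK; have E := pair_rel_config_of ncK.
have EL i : letter d r (pair_rel (config_of K)) i = letter d r K i.
  have eK : arc d r (pair_rel (config_of K)) =2 arc d r K.
    by move=> x y; rewrite /arc E.
  rewrite /letter /opener /closer E (eq_has (eK i)).
  by rewrite (eq_has (fun x => eK x (i + r))).
exists (config_of K); last first.
  apply: eq_from_tnth => i.
  by rewrite tnth_mktuple EL e modn_small // (tnth_nth (false, false)).
apply/setIdP; split=> //; rewrite -rotate_fixed_gcd //; apply/(rotate_fixedP _ ncF) => x y.
by have [_ _ _ _ Kr] := ncK; rewrite !E Kr.
Qed.

End Configurations.

Import Order.TTheory GRing.Theory Num.Theory.
Local Open Scope ring_scope.

(** * q-Catalan polynomials *)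

Section QPascal.

Variables (R : comNzRingType) (q : R).

(** Gaussian binomials by the q-Pascal recurrence: this makes sense at a root of unity, where the
    q-factorials may vanish. *)
Fixpoint qpascal (n k : nat) : R :=
  match n, k with
  | _, 0 => 1
  | 0, _.+1 => 0
  | n'.+1, k'.+1 => qpascal n' k' + q ^+ k'.+1 * qpascal n' k'.+1
  end.

Lemma qpascal0 n : qpascal n 0 = 1.
Proof. by case: n. Qed.

Lemma qpascalS n k :
  qpascal n.+1 k.+1 = qpascal n k + q ^+ k.+1 * qpascal n k.+1.
Proof. by []. Qed.

Lemma qpascal_small n k : (n < k)%N -> qpascal n k = 0.
Proof.
by elim: n k => [|n IH] [|k] //= lt; rewrite !IH ?mulr0 ?addr0 // ltnW.
Qed.

Lemma qpascal_diag n : qpascal n n = 1.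
Proof. by elim: n => //= n ->; rewrite qpascal_small // mulr0 addr0. Qed.

End QPascal.

Lemma rmorph_qpascal (R S : comNzRingType) (f : {rmorphism R -> S}) q n k :
  f (qpascal q n k) = qpascal (f q) n k.
Proof.
elim: n k => [|n IH] [|k]; rewrite ?qpascal0 ?rmorph1 //; first exact: rmorph0.
by rewrite !qpascalS rmorphD rmorphM rmorphXn !IH.
Qed.

Local Notation qX := (qpascal ('X : {poly int})).

Lemma qfact_neq0 n : qfact n != 0. Proof. exact/monic_neq0/qfact_monic. Qed.

Lemma qnum_neq0 n : qnum n.+1 != 0. Proof. exact/monic_neq0/qnum_monic. Qed.

Lemma qpascal_fact a b : qX (a + b) a * (qfact b * qfact a) = qfact (a + b).
Proof.
have qf0 : qfact 0 = 1 by rewrite /qfact big_geq.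
elim: a b => [|a IHa] b; first by rewrite qpascal0 qf0 mulr1 mul1r.
elim: b => [|b IHb]; first by rewrite addn0 qpascal_diag qf0 !mul1r.
have e1 := IHa b.+1; have e2 := IHb; rewrite addSnnS in e2.
have en : qnum (a + b.+1).+1 = qnum a.+1 + 'X^(a.+1) * qnum b.+1 by rewrite -addSn qnumD.
rewrite addSn qpascalS (qfactS (a + b.+1)) en mulrDr mulrCA -{1}e1 -e2 !qfactS; ring.
Qed.

Lemma qbinom_qpascal n k : (k <= n)%N -> qbinom n k = qX n k.
Proof.
move=> le; apply: (mulIf (mulf_neq0 (qfact_neq0 (n - k)) (qfact_neq0 k))).
by rewrite qbinomE //; have := qpascal_fact k (n - k); rewrite subnKC // => ->.
Qed.

Lemma qpascal_sym a b : qX (a + b) a = qX (a + b) b.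
Proof.
apply: (mulIf (mulf_neq0 (qfact_neq0 b) (qfact_neq0 a))).
by rewrite qpascal_fact [qfact b * _]mulrC addnC qpascal_fact.
Qed.

Lemma qpascal_absorb n k : qnum k.+1 * qX n.+1 k.+1 = qnum n.+1 * qX n k.
Proof.
have [lt|/subnKC <-] := ltnP n k; first by rewrite !qpascal_small ?mulr0.
set b := (n - k)%N; apply: (mulIf (mulf_neq0 (qfact_neq0 b) (qfact_neq0 k))).
have e1 := qpascal_fact k b; have e2 := qpascal_fact k.+1 b.
rewrite -[RHS]mulrA e1 [RHS]mulrC -qfactS -addSn -e2 qfactS; ring.
Qed.

Lemma qpascalSr n k : (k <= n)%N ->
  qX n.+1 k.+1 = 'X^(n - k) * qX n k + qX n k.+1.
Proof.
move=> /subnKC <-; case: (n - k)%N => [|b].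
  by rewrite addn0 subnn expr0 !qpascal_diag qpascal_small // mul1r addr0.
rewrite addKn; apply: (mulIf (mulf_neq0 (qfact_neq0 b.+1) (qfact_neq0 k.+1))).
have e1 := qpascal_fact k b.+1; have e2 := qpascal_fact k.+1 b.
have e3 := qpascal_fact k.+1 b.+1; rewrite addSnnS in e2; rewrite addSn in e3; rewrite e3.
have en : qnum (k + b.+1).+1 = qnum b.+1 + 'X^(b.+1) * qnum k.+1.
  by rewrite -qnumD; congr qnum; lia.
by rewrite qfactS en mulrDr mulrCA -{1}e2 -e1 !qfactS; ring.
Qed.

(** With [G] and [H] the two binomials, [G * qnum n.+1 = H * qnum n.+2]; substituting
    [qnum n.+2 = 1 + 'X * qnum n.+1] exhibits [G] as a multiple of [qnum n.+2]. *)
Lemma qCatalanS n : qCatalan n.+1 = qX (n.+1).*2 n.+1 - 'X * qX (n.+1).*2 n.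
Proof.
apply: (mulIf (qnum_neq0 n.+1)).
rewrite qCatalanE mul2n -addnn qbinom_qpascal ?leq_addl // mulrBl.
set G := qX _ n.+1; set H := qX _ n.
suff e : G * qnum n.+1 = H * qnum n.+2.
  have e1 : qnum n.+2 = 1 + 'X * qnum n.+1.
    by rewrite -add1n qnumD expr1 /qnum big_ord1 expr0.
  by rewrite -mulrA -e {1}e1; ring.
apply: (mulIf (mulf_neq0 (qfact_neq0 n.+1) (qfact_neq0 n))).
have e1 := qpascal_fact n.+1 n.+1; have e2 := qpascal_fact n n.+2.
rewrite -addSnnS in e2; rewrite -/G in e1; rewrite -/H in e2.
rewrite -[RHS]mulrA; transitivity (G * (qfact n.+1 * (qfact n * qnum n.+1))); first by ring.
by rewrite -qfactS e1 -e2 (qfactS n.+1); ring.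
Qed.

(** * Nonnegativity of the coefficients *)

Definition nonneg_coef (p : {poly int}) := forall i, 0 <= p`_i.

Lemma nonneg_coefD p p' : nonneg_coef p -> nonneg_coef p' -> nonneg_coef (p + p').
Proof. by move=> h h' i; rewrite coefD addr_ge0. Qed.

Lemma nonneg_coefXn n p : nonneg_coef p -> nonneg_coef ('X^n * p).
Proof. by move=> h i; rewrite coefXnM; case: ifP. Qed.

Lemma nonneg_coef1 : nonneg_coef 1.
Proof. by move=> i; rewrite coef1; case: eqP. Qed.

(* [ballot_poly n b] enumerates by major index the ballot words with [b] down-steps
   among [n] steps; [ballot_polyS] splits them according to the last step. *)
Definition ballot_poly (n b : nat) : {poly int} :=
  if b is c.+1 then qX n c.+1 - 'X * qX n c else 1.

Lemma ballot_polyS n c :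
  ballot_poly n.+1 c.+1 = 'X^(c.+1) * (qX n c.+1 - qX n c) + ballot_poly n c.
Proof.
rewrite /ballot_poly qpascalS; case: c => [|c]; first by rewrite !qpascal0 expr1; ring.
by rewrite qpascalS [in RHS]exprS [in LHS]exprS; ring.
Qed.

Lemma ballot_diffS n c : (c < n)%N ->
  qX n.+1 c.+1 - qX n.+1 c = (qX n c.+1 - qX n c) + 'X^(n - c) * ballot_poly n c.
Proof.
move=> lt; rewrite qpascalSr ?(ltnW lt) // /ballot_poly; case: c lt => [|c] lt.
  by rewrite !qpascal0; ring.
rewrite [qX n.+1 c.+1]qpascalSr; last by rewrite ltnW // ltnW.
have -> : (n - c = (n - c.+1).+1)%N by lia.
by rewrite [in LHS]exprS; ring.
Qed.

(** Simultaneous induction: [ballot_polyS] needs the differences of consecutive Gaussian binomials,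
    and [ballot_diffS] needs the ballot polynomials, each one row lower. *)
Lemma ballot_nonneg n :
  (forall b, (b.*2 <= n)%N -> nonneg_coef (ballot_poly n b)) /\
  (forall c, (c.*2 < n)%N -> nonneg_coef (qX n c.+1 - qX n c)).
Proof.
elim: n => [|n [IHP IHS]].
  by split=> [[|b] // _|//]; apply: nonneg_coef1.
split=> [[|c] le|c lt]; first exact: nonneg_coef1.
  rewrite ballot_polyS; apply: nonneg_coefD; last by apply: IHP; lia.
  by apply: nonneg_coefXn; apply: IHS; lia.
(* In the boundary case the two binomials are the middle ones of an odd row, equal by symmetry. *)
have [e|lt'] : n = c.*2 \/ (c.*2 < n)%N by lia.
  have -> : qX n.+1 c.+1 = qX n.+1 c.
    by rewrite e -addnn -addSn qpascal_sym.
  by rewrite subrr => i; rewrite coef0.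
rewrite ballot_diffS; last by lia.
by apply: nonneg_coefD; [exact: IHS | apply/nonneg_coefXn/IHP; lia].
Qed.

Lemma qCatalan_nonneg n : nonneg_coef (qCatalan n.+1).
Proof. by rewrite qCatalanS; apply: ((ballot_nonneg (n.+1).*2).1 n.+1). Qed.

(** * The q-Lucas theorem and values of the q-Catalan polynomial *)

Section RootOfUnity.

Variables (F : fieldType) (d : nat) (z : F).
Hypothesis prim_z : d.-primitive_root z.

Definition eval_int (P : {poly int}) : F := (map_poly intr P).[z].

Lemma eval_qpascal n k : eval_int (qX n k) = qpascal z n k.
Proof.
have e : map_poly intr (qX n k) = qpascal 'X n k :> {poly F}.
  by rewrite rmorph_qpascal /= map_polyX.
by rewrite /eval_int e -horner_evalE rmorph_qpascal /= horner_evalE hornerX.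
Qed.

Lemma eval_qnum n : eval_int (qnum n) = \sum_(i < n) z ^+ i.
Proof.
rewrite /eval_int /qnum rmorph_sum horner_sum.
by apply: eq_bigr => i _; rewrite rmorphXn /= map_polyX hornerXn.
Qed.

Lemma eval_qnum_eq0 n : (0 < n < d)%N -> eval_int (qnum n) != 0.
Proof.
move=> /andP[n0 nd]; apply/eqP => e.
have : z ^+ n = 1 by apply/eqP; rewrite -subr_eq0 subrX1 -eval_qnum e mulr0.
by move/eqP; rewrite -(prim_order_dvd prim_z) gtnNdvd.
Qed.

(** In the absorption identity [qnum d] vanishes at [z] while [qnum k] does not. *)
Lemma qpascal_prim k : (0 < k < d)%N -> qpascal z d k = 0.
Proof.
case: k => // k /andP[_ lt]; have d0 := prim_order_gt0 prim_z.
apply: (mulfI (eval_qnum_eq0 (_ : 0 < k.+1 < d)%N)) => //.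
rewrite mulr0 -eval_qpascal /eval_int -hornerM -rmorphM /=.
rewrite -{1}(prednK d0) qpascal_absorb rmorphM hornerM -/(eval_int _).
rewrite (prednK d0).
suff -> : eval_int (qnum d) = 0 by rewrite mul0r.
have /eqP : (z - 1) * eval_int (qnum d) = 0.
  by rewrite eval_qnum -subrX1 (prim_expr_order prim_z) subrr.
rewrite mulf_eq0 subr_eq0 => /orP[/eqP z1|/eqP //].
by have := prim_order_dvd prim_z 1; rewrite expr1 z1 eqxx dvdn1 => /eqP d1; rewrite d1 in lt.
Qed.

Lemma prim_exprD c e : z ^+ (c * d + e) = z ^+ e.
Proof. by rewrite exprD mulnC exprM (prim_expr_order prim_z) expr1n mul1r. Qed.

Lemma q_lucas a b c e : (b < d)%N -> (e < d)%N ->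
  qpascal z (a * d + b) (c * d + e) = 'C(a, c)%:R * qpascal z b e.
Proof.
have d0 := prim_order_gt0 prim_z.
elim: a b c e => [|a IHa] b; elim: b => [|b IHb] c e lt_b lt_e.
- rewrite mul0n addn0; case: c => [|c]; first by rewrite mul0n add0n bin0 mul1r.
  by rewrite bin0n mul0r qpascal_small // mulSn; lia.
- rewrite bin0n; case: c => [|c]; first by rewrite mul0n !add0n mul1r.
  by rewrite mul0r qpascal_small // mulSn; lia.
(* A borrow: the preceding row has last digit [d.-1]. For [e = 0] the recurrence becomes Pascal's
   rule for the leading digits; for [e > 0] the two terms combine to a multiple of [qpascal z d e],
   which vanishes. *)
- have eN : (a.+1 * d + 0 = (a * d + d.-1).+1)%N by rewrite mulSn; lia.
  have lt_d : (d.-1 < d)%N by lia.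
  rewrite eN; case: e lt_e => [|e] lt_e.
    case: c => [|c]; first by rewrite mul0n !qpascal0 bin0 mulr1.
    have eK : (c.+1 * d + 0 = (c * d + d.-1).+1)%N by rewrite mulSn; lia.
    rewrite eK qpascalS IHa // qpascal_diag -eK.
    by rewrite IHa // prim_exprD !qpascal0 binS natrD expr0; ring.
  rewrite addnS qpascalS -addnS !IHa //; last exact: ltnW.
  rewrite prim_exprD mulrCA -mulrDr -qpascalS prednK // qpascal_prim ?lt_e //.
  by rewrite qpascal_small // !mulr0.
- have lt_b' := ltnW lt_b; rewrite addnS; case: e lt_e => [|e] lt_e.
    case: c => [|c]; first by rewrite mul0n !qpascal0 bin0 mulr1.
    have eK : (c.+1 * d + 0 = (c * d + d.-1).+1)%N by rewrite mulSn; lia.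
    rewrite eK qpascalS IHb //; last lia.
    rewrite -eK IHb // prim_exprD (@qpascal_small _ _ b d.-1); last lia.
    by rewrite !qpascal0 expr0; ring.
  rewrite addnS qpascalS -addnS !IHb // ?prim_exprD; last exact: ltnW.
  by rewrite mulrCA -mulrDr -qpascalS.
Qed.

Lemma eval_qCatalan n :
  eval_int (qCatalan n.+1) = qpascal z (n.+1).*2 n.+1 - z * qpascal z (n.+1).*2 n.
Proof.
rewrite -!eval_qpascal qCatalanS /eval_int rmorphB rmorphM /= map_polyX.
by rewrite hornerD hornerN hornerM hornerX.
Qed.

End RootOfUnity.

Section CatalanAtRoot.

Variables (F : fieldType) (r : nat) (z : F).

Lemma qCatalan_prim1 : 1.-primitive_root z ->
  eval_int z (qCatalan r.+1) = 'C(r.*2.+2, r.+1)%:R - 'C(r.*2.+2, r)%:R.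
Proof.
move=> prim_z; have L a c : qpascal z a c = 'C(a, c)%:R.
  by have := q_lucas prim_z a c (isT : 0 < 1)%N (isT : 0 < 1)%N; rewrite !muln1 !addn0 mulr1.
by rewrite eval_qCatalan !L (prim_expr_order prim_z : z = 1) mul1r doubleS.
Qed.

(** The first binomial vanishes, its row having last digit 0 and its column last digit 1; as
    [z = -1], the second one enters with a plus sign. *)
Lemma qCatalan_prim2 : 2.-primitive_root z ->
  eval_int z (qCatalan (2 * r).+1) = 'C(r.*2.+1, r.+1)%:R.
Proof.
move=> prim_z; have z1 : z = -1.
  have /eqP := prim_expr_order prim_z; rewrite sqrf_eq1 => /orP[/eqP z1|/eqP //].
  by have := prim_order_dvd prim_z 1; rewrite expr1 z1 eqxx.
rewrite eval_qCatalan.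
have -> : ((2 * r).+1.*2 = r.*2.+1 * 2 + 0)%N by lia.
have -> : ((2 * r).+1 = r * 2 + 1)%N by lia.
have e : (2 * r = r * 2 + 0)%N by lia.
rewrite e !(q_lucas prim_z) // qpascal0 qpascal_small // mulr0 mulr1 z1 mulN1r sub0r opprK.
by rewrite -bin_sub ?subSS -?addnn ?addnK ?leqW ?leq_addr // -addnS addKn.
Qed.

(** The last digits contribute [(1 + z) - z = 1]; the row has last digit 2, which is below [d]. *)
Lemma qCatalan_prim3 d : (2 < d)%N -> d.-primitive_root z ->
  eval_int z (qCatalan (d * r).+1) = 'C(r.*2, r)%:R.
Proof.
move=> d_gt2 prim_z; rewrite eval_qCatalan.
have -> : ((d * r).+1.*2 = r.*2 * d + 2)%N by lia.
have -> : ((d * r).+1 = r * d + 1)%N by lia.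
have e : (d * r = r * d + 0)%N by lia.
rewrite e !(q_lucas prim_z) //=; try lia.
by rewrite expr1; ring.
Qed.

End CatalanAtRoot.

(** * Roots of unity and cyclic sieving *)

(** Reconciles the two forms of the Catalan number, from the path count and from the q-Catalan
    polynomial, by Pascal's rule and symmetry. *)
Lemma central_binS r a : (0 < r)%N -> (a + 'C(r.*2.+1, r + 2) = 'C(r.*2.+1, r + 1) ->
  a + 'C(r.*2.+2, r) = 'C(r.*2.+2, r.+1))%N.
Proof.
case: r => // r _; have : 'C(r.+1.*2.+1, r) = 'C(r.+1.*2.+1, r.+1 + 2).
  by rewrite -[RHS]bin_sub; [congr 'C(_, _); lia | lia].
by move: (r.+1.*2.+1) => N; rewrite addn2 addn1 !binS; lia.
Qed.

Lemma admissible_qCatalan (F : fieldType) (d r : nat) (z : F) : (0 < r)%N ->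
  d.-primitive_root z ->
  #|[set t : r.-tuple (bool * bool) | admissible d r (nth (false, false) t)]|%:R =
  eval_int z (qCatalan (d * r).+1).
Proof.
move=> r_gt0 prim_z; have d_gt0 := prim_order_gt0 prim_z.
case: (ltngtP d 2) => [lt|gt|d2].
- have d1 : d = 1%N by lia.
  rewrite d1 in prim_z *; rewrite mul1n qCatalan_prim1 //; apply/eqP.
  rewrite -subr_eq opprK -natrD; apply/eqP; congr _%:R.
  by apply: central_binS => //; apply: card_admissible1.
- by rewrite qCatalan_prim3 // card_admissible3.
by rewrite d2 in prim_z *; rewrite qCatalan_prim2 // card_admissible2.
Qed.

Section Expi.

Variable R : realType.

Lemma expiD (a b : R) : expi (a + b) = expi a * expi b.
Proof.
apply/eqP; rewrite eq_complex /= cosD sinD; apply/andP; split; apply/eqP; ring.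
Qed.

Lemma expi0 : expi (0 : R) = 1.
Proof. by rewrite /expi cos0 sin0. Qed.

Lemma expiMn (a : R) n : expi (a *+ n) = expi a ^+ n.
Proof.
by elim: n => [|n IH]; rewrite ?mulr0n ?expi0 // mulrS expiD IH exprS.
Qed.

Lemma expi_2pi : expi (2%:R * pi : R) = 1.
Proof. by rewrite /expi mulr_natl cos2pi sin2pi. Qed.

Lemma expi_2pi_int (q : int) : expi (2%:R * pi * q%:~R : R) = 1.
Proof.
have N n : expi (2%:R * pi * n%:R : R) = 1.
  by rewrite mulr_natr expiMn expi_2pi expr1n.
case: q => n; first exact: N.
rewrite NegzE mulrNz mulrN -[LHS]mul1r -[X in X * _](N n.+1) -expiD.
by rewrite subrr expi0.
Qed.

Lemma expi_neq1 (a : R) : 0 < a < 2%:R * pi -> expi a != 1.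
Proof.
move=> /andP[a0 a2]; apply/negP => /eqP [].
have -> : a = (a / 2%:R) *+ 2 by rewrite -mulr_natr divfK ?pnatr_eq0.
(* Here [cos a = 1] forces [sin (a / 2) = 0], but [a / 2] lies strictly between 0 and [pi]. *)
rewrite cos_mulr2n => e _.
have s0 : 0 < sin (a / 2%:R) by apply: sin_gt0_pi; lra.
have := cos2Dsin2 (a / 2%:R); have : 0 < sin (a / 2%:R) ^+ 2 by rewrite exprn_gt0.
lra.
Qed.

Lemma expi_prim m : (0 < m)%N -> m.-primitive_root (expi (2%:R * pi / m%:R : R)).
Proof.
move=> m_gt0; rewrite /primitive_root_of_unity m_gt0; apply/forallP => i.
have m0 : m%:R != 0 :> R by rewrite pnatr_eq0 -lt0n.
rewrite unity_rootE -expiMn; apply/eqP; case: (ltngtP i.+1 m) => [lt|gt|e].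
- apply/negbTE/expi_neq1; rewrite pmulrn_lgt0 // divr_gt0 ?mulr_gt0 ?pi_gt0 ?ltr0n //=.
  rewrite -[_ *+ i.+1]mulr_natr [_ / _ * _]mulrAC ltr_pdivrMr ?ltr0n //.
  by rewrite ltr_pM2l ?mulr_gt0 ?pi_gt0 ?ltr0n // ltr_nat.
- by have := ltn_ord i; lia.
by rewrite e -[_ *+ m]mulr_natr divfK // expi_2pi eqxx.
Qed.

Lemma expi_frac m (j : nat) (q : int) : (0 < m)%N ->
  expi (2%:R * pi * (j%:Z + q * m%:Z)%:~R / m%:R : R) = expi (2%:R * pi / m%:R) ^+ j.
Proof.
move=> m_gt0; have m0 : m%:R != 0 :> R by rewrite pnatr_eq0 -lt0n.
rewrite -expiMn -[RHS]mulr1 -(expi_2pi_int q) -expiD; congr expi.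
rewrite rmorphD rmorphM /= -[_ *+ j]mulr_natr; field.
by [].
Qed.

End Expi.

Lemma expgzE (gT : finGroupType) (x : gT) m (k : int) : (0 < m)%N -> (x ^+ m = 1)%g ->
  exists (j : nat) (q : int), k = j%:Z + q * m%:Z /\ expgz x k = (x ^+ j)%g.
Proof.
move=> m_gt0 xm; case: k => a /=; first by exists a, 0; rewrite mul0r addr0.
(* The inverse of [x] is [x ^+ m.-1]. *)
exists (a.+1 * m.-1)%N, (- a.+1%:Z); split.
  by rewrite NegzE -{2}(prednK m_gt0) PoszM -[m.-1.+1]addn1 PoszD; ring.
apply/eqP; rewrite eq_invg_mul -expgD -{1}[a.+1]muln1 -mulnDr add1n prednK //.
by rewrite mulnC expgM xm expg1n.
Qed.

Lemma set_actE (T : finType) (F : {set {set T}}) (c : {perm T}) :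
  ('P^*^*)%act F c = [set c @: (A : {set T}) | A in F].
Proof. by []. Qed.

Section CyclicSieving.

Variables (R : realType) (p : nat).
Let m := p.+1.
Let g := cshift m.
Let zeta : R[i] := expi (2%:R * pi / m%:R).

Let prim_zeta : m.-primitive_root zeta. Proof. exact: expi_prim. Qed.

(** The root [zeta ^+ k] is primitive of order [m %/ gcdn m k], the same order as that of the
    rotation by [k]. *)
Lemma card_fixed_eval k :
  #|[set F in nc_configurations m | rotate k F == F]|%:R = evalC (qCatalan m.+1) (zeta ^+ k).
Proof.
have prim_k := exp_prim_root prim_zeta k; rewrite gcdnC in prim_k.
rewrite card_rotate_fixed (admissible_qCatalan _ prim_k) ?gcdn_gt0 //.
by rewrite divnK // dvdn_gcdl.
Qed.

Lemma card_fixed_eval_int k :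
  #|[set F in nc_configurations m |
      [set expgz g k @: (A : {set 'I_m}) | A in F] == F]|%:R
  = evalC (qCatalan m.+1) (expi (2%:R * pi * k%:~R / m%:R : R)).
Proof.
have gm : (g ^+ m = 1)%g by have := expg_order g; rewrite order_cshift.
have [j [q [-> ->]]] := expgzE k (ltn0Sn p) gm.
by rewrite expi_frac // card_fixed_eval.
Qed.

(** The exponent of a power of [g] is read off modulo [m] from the image of the first point. *)
Definition shift_root (s : 'S_m) : R[i] := zeta ^+ s ord0.

Lemma shift_rootX k : shift_root (g ^+ k)%g = zeta ^+ k.
Proof. by rewrite /shift_root cshiftX add0n (prim_expr_mod prim_zeta). Qed.

Lemma shift_root_embedding : root_embedding <[g]>%G shift_root.
Proof.
split.
- move=> x y /cycleP[a ->] /cycleP[b ->].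
  by rewrite -expgD !shift_rootX exprD.
- move=> x y /cycleP[a ->] /cycleP[b ->]; rewrite !shift_rootX => /eqP.
  rewrite (eq_prim_root_expr prim_zeta) => e; apply/eqP.
  by rewrite eq_expg_mod_order order_cshift.
move=> z; rewrite -orderE order_cshift //; split=> [/(prim_rootP prim_zeta)[i ->]|].
  by exists (g ^+ i)%g; rewrite ?mem_cycle ?shift_rootX.
move=> [c /cycleP[k ->] <-].
by rewrite shift_rootX exprAC (prim_expr_order prim_zeta) expr1n.
Qed.

Lemma cyclic_sieving :
  exhibits_CSP ('P^*^*)%act (nc_configurations m) <[g]>%G (qCatalan m.+1) shift_root.
Proof.
split.
- exact: cycle_cyclic.
- apply/subsetP => c /cycleP[k ->]; rewrite !inE /=; apply/subsetP => F ncF.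
  by rewrite inE; apply: rotate_nc.
- exact: qCatalan_nonneg.
- exact: shift_root_embedding.
move=> c /cycleP[k ->]; rewrite shift_rootX; exact: card_fixed_eval.
Qed.

End CyclicSieving.

(** * The empty ground set and the conclusion *)

Lemma nc_configurations0 : nc_configurations 0 = [set set0].
Proof.
apply/setP => F; rewrite !inE; apply/idP/eqP => [/andP[/andP[/forall_inP cF _] _]|->].
  apply/setP => A; rewrite inE; apply/negP => /cF.
  have -> : A = set0 by apply/setP => -[].
  by rewrite /is_ball /is_arc cards0.
apply/andP; split; [apply/andP; split|].
- by apply/forall_inP => A; rewrite inE.
- by apply/trivIsetP => A B; rewrite inE.
- by apply/negP => /existsP[[]].
Qed.

Lemma eval_qCatalan1 (R : realType) : evalC (qCatalan 1) (1 : R[i]) = 1.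
Proof.
have := @expi_prim R 1 isT; rewrite divr1 expi_2pi => prim1.
have := qCatalan_prim1 0 prim1; rewrite /eval_int /evalC => ->.
by rewrite /= -natrB.
Qed.

Theorem theorem1p3 (R : realType) (n : nat) (hn : (0 < n)%N) :
  (exists omega : 'S_(n.-1) -> R[i],
     (forall k : int, omega (expgz (cshift n.-1) k) =
                      expi (2%:R * pi * k%:~R / (n.-1)%:R)) /\
     exhibits_CSP ('P^*^*)%act (nc_configurations n.-1) <[cshift n.-1]>%G
       (qCatalan n) omega) /\
  (forall k : int,
     #|[set F in nc_configurations n.-1 |
          [set expgz (cshift n.-1) k @: (A : {set 'I_(n.-1)}) | A in F] == F]|%:R
     = evalC (qCatalan n) (expi (2%:R * pi * k%:~R / (n.-1)%:R : R))).
Proof.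
case: n hn => // -[|p] _ /=.
  have S1 (s : 'S_0) : s = 1%g by apply/permP => -[].
  have card1 (f : {set {set 'I_0}} -> {set {set 'I_0}}) : f set0 = set0 ->
      #|[set F in nc_configurations 0 | f F == F]| = 1%N.
    move=> f0; apply/eqP/cards1P; exists set0; apply/setP => F.
    rewrite nc_configurations0 !inE; case: (F =P set0) => [->|//].
    by rewrite f0 eqxx.
  (* For [n = 1] the denominator is 0; since the inverse of 0 is 0 by convention, the angle is 0 and
     the root is 1. *)
  have e0 k : expi (2%:R * pi * k%:~R / 0%:R : R) = 1 by rewrite invr0 mulr0 expi0.
  split=> [|k]; last by rewrite e0 eval_qCatalan1 card1 // imset0.
  exists (fun _ => 1); split=> [k|]; first by rewrite e0.
  split.
  - exact: cycle_cyclic.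
  - by apply/subsetP => c _; rewrite (S1 c) group1.
  - exact: qCatalan_nonneg.
  - split=> [x y|x y|z]; first by rewrite mulr1.
      by rewrite (S1 x) (S1 y).
    have -> : #|<[cshift 0]>%G| = 1%N by rewrite -orderE (S1 (cshift 0)) order1.
    rewrite expr1.
    by split=> [->|[c _ <-] //]; exists 1%g; rewrite ?group1.
  move=> c _; rewrite eval_qCatalan1 card1 // set_actE; exact: imset0.
split; last exact: card_fixed_eval_int.
exists (@shift_root R p); split; last exact: cyclic_sieving.
move=> k; have gm : (cshift p.+1 ^+ p.+1 = 1)%g.
  by have := expg_order (cshift p.+1); rewrite order_cshift.
have [j [q [-> ->]]] := expgzE k (ltn0Sn p) gm.
by rewrite shift_rootX expi_frac.
Qed.
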